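(* Suppose Assumption 1 (path realization) and Assumption 2 (additivity along the core, $\mathcal H_\kappa=\mathcal A(\gamma)$) hold. Let $B_r:=\{h_\perp\in\mathcal H_\kappa^\perp\cap\mathcal T:\|h_\perp\|\le r\}$ for $r>0$, let $D:=\sup_{h\in B_1}\gamma(h)-\inf_{h\in B_1}\gamma(h)$ (which is finite), and let $$\mathcal M_\perp(B_r):=\inf_{T_\perp}\sup_{h_\perp\in B_r}\mathbb E_{h_\perp}(T_\perp-\gamma(h_\perp))^2,$$ the infimum over randomized statistics $T_\perp$ of $Z_\perp$ in the Gaussian-shift experiment described in the context. Then $$\frac{D^2r^2}{4}\Big(1-\frac{2r}{\sqrt{2\pi}}\Big)_+\ \le\ \mathcal M_\perp(B_r)\ \le\ \frac{D^2r^2}{4},\qquad\text{hence}\qquad\mathcal M_\perp(B_r)=\frac{D^2}{4}r^2+o(r^2)\quad(r\downarrow0).$$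
   Context: Model. $P$ is a fixed element of a set $\mathcal P$ of probability measures; $L_2^0(P)$ is the mean-zero subspace of $L_2(P)$ with inner product $\langle\cdot,\cdot\rangle$ and norm $\|\cdot\|$. A DQM path with score $h$ is a map $t\mapsto P_t\in\mathcal P$, $t\in[0,\varepsilon)$, $P_0=P$, with $\int[(dP_t^{1/2}-dP^{1/2})/t-\tfrac12h\,dP^{1/2}]^2\to0$ as $t\downarrow0$. The tangent space $\mathcal T\subseteq L_2^0(P)$ is a linear subspace. Assumption 1: $\mathcal T$ is closed in $L_2(P)$ and every $h\in\mathcal T$ is the score of some DQM path in $\mathcal P$. $\gamma:\mathcal T\to\mathbb R$ is the positively homogeneous directional derivative of $\Psi:\mathcal P\to\mathbb R$ at $P$: $t^{-1}\{\Psi(P_t)-\Psi(P)\}\to\gamma(h)$ as $t\downarrow0$ for every $h\in\mathcal T$ and every DQM path with score $h$; $\gamma$ is then continuous. $N(\gamma):=\{h\in\mathcal T:\gamma(h)+\gamma(-h)=0\}$. Core: $\mathcal H_\kappa:=\{w\in N(\gamma):\gamma(v+cw)=\gamma(v)+c\gamma(w)\ \forall v\in N(\gamma),c\in\mathbb R\}$, a closed linear subspace on which $\gamma$ is linear. Additivity space: $\mathcal A(\gamma):=\{w\in\mathcal T:\gamma(h+w)=\gamma(h)+\gamma(w)\ \forall h\in\mathcal T\}$. Assumption 2: $\mathcal H_\kappa=\mathcal A(\gamma)$. Experiment. $\Delta$ is the isonormal process (centred Gaussian, $\operatorname{Cov}(\Delta(g),\Delta(g'))=\langle g,g'\rangle$).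 Under $h_\perp\in\mathcal H_\kappa^\perp\cap\mathcal T$ one observes $Z_\perp=\Delta+\langle h_\perp,\cdot\rangle$, a process indexed by $\mathcal H_\kappa^\perp\cap\mathcal T$. Randomized statistics are real-valued measurable functions of the observation and independent auxiliary randomization. $(x)_+=\max(x,0)$. *)

(* Defs.v *)
From HB Require Import structures.
From mathcomp Require Export all_boot all_order all_algebra.
From mathcomp Require Export all_classical all_reals all_analysis.

Set Implicit Arguments.
Unset Strict Implicit.
Unset Printing Implicit Defensive.
Export Order.TTheory GRing.Theory Num.Theory numFieldNormedType.Exports.

Local Open Scope classical_set_scope.
Local Open Scope ring_scope.

(* Elements of L_2(P) are square-integrable functions, not classes: the library
   equips functions, but not their a.e. classes, with a module structure.
   The seminorm [l2norm] vanishes on the functions that are 0 P-a.e. *)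
Notation L2 P := (LfunType P (lee1n 2)).

Section L2_geometry.
Context d (X : measurableType d) (R : realType) (P : probability X R).
Implicit Types (f g h : L2 P) (T : set (L2 P)).

Definition l2dot f g : R := fine (\int[P]_x (f x * g x)%:E).

Definition l2norm f : R := fine ('N[P]_2%:E[EFin \o f])%E.

Definition mean_zero h : Prop := ('E_P[h] = 0)%E.

Definition linear_subspace T : Prop :=
  T 0 /\ forall (a : R) f g, T f -> T g -> T (a *: f + g).

(* A closed set is in particular saturated for P-a.e. equality. *)
Definition l2closed T : Prop :=
  forall h, (forall e : R, 0 < e -> exists2 g, T g & l2norm (g - h) < e) -> T h.

End L2_geometry.

Section measure_add_finite.
Context d (X : measurableType d) (R : realType) (P Q : probability X R).

HB.instance Definition _ := Measure.copy (measure_add P Q)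
  (msum (fun n => if n is 0%N then (P : {measure set X -> \bar R}) else Q) 2).

Lemma measure_add_fin_num_fun : fin_num_fun (measure_add P Q).
Proof.
by move=> A mA; rewrite measure_addE fin_numD !fin_num_measure.
Qed.

HB.instance Definition _ :=
  Measure_isFinite.Build _ _ _ (measure_add P Q) measure_add_fin_num_fun.

End measure_add_finite.

Section differentiability_in_quadratic_mean.
Context d (X : measurableType d) (R : realType) (P : probability X R).
Implicit Types (PP : set (probability X R)) (p : R -> probability X R)
  (h : L2 P).

Definition sqrt_density (Q : probability X R)
    (mu : {sigma_finite_measure set X -> \bar R}) (x : X) : R :=
  Num.sqrt (fine (Radon_Nikodym (charge_of_finite_measure Q) mu x)).

(* The symbolic integral of [(dQ^{1/2} - dP^{1/2})/t - h dP^{1/2}/2]^2 does not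
   depend on the dominating measure; P + Q is one. *)
Definition dqm_error (Q : probability X R) h (t : R) : \bar R :=
  let mu := measure_add P Q in
  (\int[mu]_x (((sqrt_density Q mu x - sqrt_density P mu x) / t
                 - 2^-1 * h x * sqrt_density P mu x) ^+ 2)%:E)%E.

(* Only the values of p on [0, eps[ matter. *)
Definition DQM_path PP p h : Prop :=
  [/\ exists2 eps : R, 0 < eps & forall t, 0 <= t < eps -> PP (p t),
      p 0 = P
    & dqm_error (p t) h t @[t --> 0^'+] --> 0%E].

Definition path_realization PP (T : set (L2 P)) : Prop :=
  l2closed T /\ forall h, T h -> exists p, DQM_path PP p h.

Definition directional_derivative PP (Psi : probability X R -> R)
    (T : set (L2 P)) (gamma : L2 P -> R) : Prop :=
  (forall (c : R) h, 0 < c -> T h -> gamma (c *: h) = c * gamma h) /\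
  (forall h p, T h -> DQM_path PP p h ->
    t^-1 * (Psi (p t) - Psi P) @[t --> 0^'+] --> gamma h).

End differentiability_in_quadratic_mean.

Section core.
Context d (X : measurableType d) (R : realType) (P : probability X R).
Variables (T : set (L2 P)) (gamma : L2 P -> R).

Definition Ngamma : set (L2 P) :=
  [set h | T h /\ gamma h + gamma (- h) = 0].

Definition core : set (L2 P) :=
  [set w | Ngamma w /\ forall v (c : R), Ngamma v ->
    gamma (v + c *: w) = gamma v + c * gamma w].

Definition additivity_space : set (L2 P) :=
  [set w | T w /\ forall h, T h -> gamma (h + w) = gamma h + gamma w].

Definition core_perp : set (L2 P) :=
  [set h | T h /\ forall w, core w -> l2dot h w = 0].

Definition perp_ball (r : R) : set (L2 P) :=
  [set h | core_perp h /\ l2norm h <= r].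

Definition perp_range : R :=
  sup (gamma @` perp_ball 1) - inf (gamma @` perp_ball 1).

End core.

Section gaussian.
Context d (Omega : measurableType d) (R : realType) (Q : probability Omega R).

Definition iid_std_normal k (xi : 'I_k -> {RV Q >-> R}) : Prop :=
  forall B : 'I_k -> set R, (forall j, measurable (B j)) ->
    Q [set w | forall j, B j (xi j w)] =
    (\prod_(j < k) normal_prob 0 1 (B j))%E.

End gaussian.

(* Finite-dimensional laws are those of linear images of standard Gaussian
   vectors; this covers degenerate covariances. *)
Definition centred_gaussian_process d (Omega : measurableType d) (R : realType)
    (Q : probability Omega R) (I : Type) (X : I -> {RV Q >-> R}) : Prop :=
  forall n (g : 'I_n -> I),
  exists k (A : 'M[R]_(n, k)) d' (Omega' : measurableType d')
    (Q' : probability Omega' R) (xi : 'I_k -> {RV Q' >-> R}),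
    iid_std_normal xi /\
    forall B : set (n.-tuple R), measurable B ->
      Q [set w | B [tuple X (g i) w | i < n]] =
      Q' [set w | B [tuple \sum_(j < k) A i j * xi j w | i < n]].

Section gaussian_shift.
Context d (X : measurableType d) (R : realType) (P : probability X R).
Context d' (Omega : measurableType d') (Q : probability Omega R).

Definition isonormal (K : set (L2 P)) (Delta : K -> {RV Q >-> R}) : Prop :=
  centred_gaussian_process Delta /\
  forall g g' : K,
    covariance Q (Delta g) (Delta g') = (l2dot (val g) (val g'))%:E.

(* Real functions on K, with the sigma-algebra generated by the evaluations. *)
Definition observation (K : set (L2 P)) :=
  g_sigma_algebraType (\bigcup_(g in [set: K])
    preimage_set_system [set: K -> R] (fun z => z g) measurable).

Definition shifted (K : set (L2 P)) (Delta : K -> {RV Q >-> R}) (h : L2 P)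
    (w : Omega) : observation K :=
  fun g => Delta g w + l2dot h (val g).

Variables (T : set (L2 P)) (gamma : L2 P -> R).
Let K := core_perp T gamma.

(* Delta and the auxiliary randomization u are independent under Q \x q. *)
Definition risk (Delta : K -> {RV Q >-> R}) dU (U : measurableType dU)
    (q : probability U R) (S : observation K * U -> R) (h : L2 P) : \bar R :=
  (\int[Q \x q]_wu ((S (shifted Delta h wu.1, wu.2) - gamma h) ^+ 2)%:E)%E.

Definition minimax_risk (Delta : K -> {RV Q >-> R}) (r : R) : \bar R :=
  ereal_inf [set v | exists dU (U : measurableType dU) (q : probability U R)
      (S : observation K * U -> R), measurable_fun [set: observation K * U] S /\
    v = ereal_sup [set risk Delta q S h | h in perp_ball T gamma r]].

End gaussian_shift.

(* Main.v *)
(* The map gamma is bounded on the unit ball of T: otherwise there are scores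
   g_n -> 0 with |gamma(g_n)| >= 1, and points P_(t_n) of DQM paths with scores
   g_n, t_n -> 0, can be glued into one DQM path with score 0 along which the
   difference quotients of Psi do not tend to gamma(0) = 0.  By homogeneity the
   constant statistic r (sup + inf) / 2 then has maximal risk D^2 r^2 / 4.
   For the lower bound, two shifts h1, h2 in B_r with s = |h1 - h2| <= 2 r have
   laws at total variation distance P(|N(0,1)| <= s / 2) <= s / sqrt (2 pi), so
   every statistic has average risk at least
   (gamma(h1) - gamma(h2))^2 / 4 * (1 - 2 r / sqrt (2 pi)) on {h1, h2}; then
   gamma(h1) - gamma(h2) approaches D r.  The likelihood ratio of the two shifts
   is the Cameron-Martin density exp (Delta(h) - |h|^2 / 2), obtained by shifting
   the coordinates of a standard Gaussian vector one at a time. *)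

From HB Require Import structures.
Require Import Defs.
From mathcomp Require Import measurable_realfun ring lra.

Set Implicit Arguments.
Unset Strict Implicit.
Unset Printing Implicit Defensive.

Local Open Scope classical_set_scope.
Local Open Scope ring_scope.

(** * Equality of laws *)

(** A finite part of [Delta] is known only through its law: it is a linear image, by some
    unspecified matrix, of standard normals living on another probability space. Gaussian
    computations are therefore phrased as integrals of functions of finite tuples, which transfer
    between spaces with equal laws. The matrix must then be tied to [l2dot], and this requires the
    first two moments of linear forms in standard normals. The constant arises as follows. With s
    the norm of h1 - h2, the likelihood ratio crosses 1 where the Gaussian coordinate along h1 - h2
    equals s^2 / 2. The mass not shared by the two laws is that of an interval of length s^2 under
    N(0, s^2), whose density never exceeds 1 / (s sqrt (2 pi)). The map gamma is only positively
    homogeneous, so its boundedness has to come from the paths. Gluing works because the error of a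
    path is quadratic: replacing a score g by 0 adds at most |g|^2 / 2 to twice the error, and away
    from the chosen times the glued path rests at P. *)

Lemma ge0_integral_eq_law d1 d2 d (T1 : measurableType d1)
    (T2 : measurableType d2) (T : measurableType d) (R : realType)
    (m1 : {measure set T1 -> \bar R}) (m2 : {measure set T2 -> \bar R})
    (X : T1 -> T) (Y : T2 -> T) (f : T -> \bar R) :
  measurable_fun setT X -> measurable_fun setT Y ->
  (forall A, measurable A -> m1 (X @^-1` A) = m2 (Y @^-1` A)) ->
  measurable_fun setT f -> (forall x, 0 <= f x)%E ->
  (\int[m1]_x f (X x) = \int[m2]_x f (Y x))%E.
Proof.
move=> mX mY XY mf f0.
have := @ge0_integral_pushforward _ _ _ _ R X mX m1 setT f
  measurableT mf (fun x _ => f0 x).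
have := @ge0_integral_pushforward _ _ _ _ R Y mY m2 setT f
  measurableT mf (fun x _ => f0 x).
rewrite !preimage_setT /comp /= => <- <-.
by apply: eq_measure_integral => A mA _; exact: XY.
Qed.

Lemma integral_eq_law d1 d2 d (T1 : measurableType d1)
    (T2 : measurableType d2) (T : measurableType d) (R : realType)
    (m1 : {measure set T1 -> \bar R}) (m2 : {measure set T2 -> \bar R})
    (X : T1 -> T) (Y : T2 -> T) (f : T -> \bar R) :
  measurable_fun setT X -> measurable_fun setT Y ->
  (forall A, measurable A -> m1 (X @^-1` A) = m2 (Y @^-1` A)) ->
  measurable_fun setT f ->
  (\int[m1]_x f (X x) = \int[m2]_x f (Y x))%E.
Proof.
move=> mX mY XY mf; rewrite integralE [RHS]integralE.
have := ge0_integral_eq_law mX mY XY (measurable_funepos mf) (funepos_ge0 f).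
have := ge0_integral_eq_law mX mY XY (measurable_funeneg mf) (funeneg_ge0 f).
move=> EN EP; congr (_ - _)%E.
  have XE : (fun x => f (X x))^\+%E = (f^\+)%E \o X := funepos_comp f X.
  have YE : (fun x => f (Y x))^\+%E = (f^\+)%E \o Y := funepos_comp f Y.
  by rewrite XE YE.
have XE : (fun x => f (X x))^\-%E = (f^\-)%E \o X := funeneg_comp f X.
have YE : (fun x => f (Y x))^\-%E = (f^\-)%E \o Y := funeneg_comp f Y.
by rewrite XE YE.
Qed.

(** The condition [G setT] makes the total masses agree, so that finiteness of [m1] is enough for
    uniqueness. *)
Lemma eq_law_pi_system d1 d2 d (T1 : measurableType d1)
    (T2 : measurableType d2) (T : measurableType d) (R : realType)
    (m1 : {measure set T1 -> \bar R}) (m2 : {measure set T2 -> \bar R})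
    (X : T1 -> T) (Y : T2 -> T) (G : set (set T)) :
  measurable_fun setT X -> measurable_fun setT Y ->
  measurable = <<s G >> -> setI_closed G -> G setT ->
  (m1 setT < +oo)%E ->
  (forall A, G A -> m1 (X @^-1` A) = m2 (Y @^-1` A)) ->
  forall A, measurable A -> m1 (X @^-1` A) = m2 (Y @^-1` A).
Proof.
move=> mX mY mG GI GT m1oo XY A mA.
rewrite -[LHS]/(pushforward m1 X A) -[RHS]/(pushforward m2 Y A).
apply: (measure_unique G (fun=> setT)) => //.
by rewrite bigcup_const.
Qed.

Lemma ge0_integral_translation (R : realType) (f : R -> \bar R) (c : R) :
  measurable_fun setT f -> (forall x, 0 <= f x)%E ->
  (\int[lebesgue_measure]_x f (x + c)%R = \int[lebesgue_measure]_x f x)%E.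
Proof.
move=> mf f0.
have mc : measurable_fun [set: measurableTypeR R] ((fun x => x + c) : R -> measurableTypeR R).
  exact: measurable_funD.
apply: (@ge0_integral_eq_law _ _ _ (measurableTypeR R) (measurableTypeR R)
  (measurableTypeR R) R lebesgue_measure lebesgue_measure (fun x => x + c) id) => // A mA.
rewrite preimage_id; apply/esym.
rewrite -[RHS]/(pushforward lebesgue_measure ((fun x => x + c) : _ -> measurableTypeR R) A).
apply: lebesgue_measure_unique => // _ [[a b]] _ <-.
rewrite -[RHS]/(lebesgue_measure ((fun x => x + c) @^-1` `]a, b]%classic)).
rewrite [in RHS](_ : _ @^-1` _ = `]a - c, b - c]%classic); last first.
  by apply/seteqP; split => x /=; rewrite !in_itv/= ltrBlDr lerBrDr.
rewrite !lebesgue_measure_itv/= !lte_fin ltrD2r; case: ifP => // _.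
by rewrite -!EFinB; congr EFin; ring.
Qed.

(** The density [normal_pdf] and the Radon-Nikodym derivative have the same integral over every
    measurable set, hence agree almost everywhere. *)
Lemma ge0_integral_normal_prob (R : realType) (m s : R) (f : R -> \bar R) :
  measurable_fun setT f -> (forall x, 0 <= f x)%E ->
  (\int[normal_prob m s]_x f x =
   \int[lebesgue_measure]_x (f x * (normal_pdf m s x)%:E))%E.
Proof.
move=> mf f0.
have dom := @normal_prob_dominates R m s.
rewrite -(@Radon_Nikodym_SigmaFinite.change_of_variables _ _ _ (normal_prob m s)
  lebesgue_measure dom f setT f0 measurableT mf).
apply: ae_eq_integral => //.
- apply: emeasurable_funM => //.
  exact: measurable_int (Radon_Nikodym_SigmaFinite.f_integrable dom).
- apply: emeasurable_funM => //; apply/measurable_EFinP.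
  exact: measurable_normal_pdf.
- apply: ae_eqe_mul2l.
  apply: integral_ae_eq => //.
  + exact: Radon_Nikodym_SigmaFinite.f_integrable.
  + by apply/measurable_EFinP; exact: measurable_normal_pdf.
  + by move=> A _ mA; rewrite -Radon_Nikodym_SigmaFinite.f_integral.
Qed.

(** Lets the right side of the Cameron-Martin formula be treated as a measure, to be compared with a
    law on a pi-system. *)
Lemma exists_density_measure d (T : measurableType d) (R : realType)
    (mu : {measure set T -> \bar R}) (f : T -> \bar R) :
  measurable_fun setT f -> (forall x, 0 <= f x)%E ->
  exists m : {measure set T -> \bar R},
    forall A, m A = (\int[mu]_(x in A) f x)%E.
Proof.
move=> mf f0.
pose m A := (\int[mu]_(x in A) f x)%E.
have m0 : m set0 = 0%E by rewrite /m integral_set0.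
have mge0 A : (0 <= m A)%E by apply: integral_ge0.
have ms : semi_sigma_additive m.
  move=> A mA tA mUA; rewrite /m ge0_integral_bigcup//.
    apply: is_cvg_ereal_nneg_natsum_cond => n _ _; exact: integral_ge0.
  exact: measurable_funTS.
pose mM := isMeasure.Build d T R m m0 mge0 ms.
pose m' : {measure set T -> \bar R} := HB.pack m mM.
by exists m'.
Qed.

(** * The Cameron-Martin formula for standard Gaussian vectors *)

Definition rectangle (R : realType) n (B : 'I_n -> set R) : set (n.-tuple R) :=
  [set x | forall i, B i (tnth x i)].

Lemma measurable_rectangle (R : realType) n (B : 'I_n -> set R) :
  (forall i, measurable (B i)) -> measurable (rectangle B).
Proof.
move=> mB.
have -> : rectangle B = \big[setI/setT]_(i < n) ((fun x => tnth x i) @^-1` B i).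
  by rewrite -bigcap_seq; apply/seteqP; split=> [x xB i _|x xB i];
    [exact: xB|apply: (xB i); rewrite /= mem_index_enum].
apply: bigsetI_measurable => i _.
by rewrite -[X in measurable X]setTI; apply: measurable_tnth.
Qed.

(** Sets constraining a single coordinate generate the sigma-algebra but are not stable under
    intersection; rectangles are, and independence is a statement about them. *)
Lemma measurable_rectangles (R : realType) n :
  @measurable _ (n.-tuple R) =
  <<s [set A | exists2 B : 'I_n -> set R,
        (forall i, measurable (B i)) & A = rectangle B] >>.
Proof.
apply/seteqP; split.
  apply: smallest_sub; first exact: smallest_sigma_algebra.
  rewrite -bigcup_seq; apply: bigcup_sub => i _ _ [B mB <-].
  apply: sub_sigma_algebra.
  exists (fun j => if j == i then B else setT).
    by move=> j; case: ifP.
  rewrite setTI; apply/seteqP; split=> x /=.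
    by move=> xB j; case: eqP => [->|].
  by move=> /(_ i); rewrite eqxx.
apply: smallest_sub; first exact: sigma_algebra_measurable.
by move=> _ [B mB ->]; exact: measurable_rectangle.
Qed.

Lemma rectangleI (R : realType) n (B C : 'I_n -> set R) :
  rectangle B `&` rectangle C = rectangle (fun i => B i `&` C i).
Proof.
by apply/seteqP; split=> [x [xB xC] i|x xBC]; [split|split=> i; case: (xBC i)].
Qed.

Lemma measurable_mktuple d (T : measurableType d) (R : realType) n
    (X : 'I_n -> T -> R) :
  (forall i, measurable_fun setT (X i)) ->
  measurable_fun setT (fun w => [tuple X i w | i < n]).
Proof.
move=> mX; apply/measurable_fun_tnthP => i.
by rewrite (_ : _ \o _ = X i)//; apply/funext => w /=; rewrite tnth_mktuple.
Qed.

(** Completing the square: the exponential is the density of N(t, 1) relative to N(0, 1). *)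
Lemma normal_pdf01_translation (R : realType) (t x : R) :
  normal_pdf 0 1 (x - t) = expR (t * x - t ^+ 2 / 2) * normal_pdf 0 1 x.
Proof.
rewrite !normal_pdfE ?oner_neq0// /normal_fun mulrCA -expRD.
by congr (_ * expR _); rewrite !expr1n !subr0; field.
Qed.

Lemma ge0_integral_normal_translation (R : realType) (t : R) (f : R -> \bar R) :
  measurable_fun setT f -> (forall x, 0 <= f x)%E ->
  (\int[normal_prob 0 1]_x f (x + t)%R =
   \int[normal_prob 0 1]_x (f x * (expR (t * x - t ^+ 2 / 2))%:E))%E.
Proof.
move=> mf f0.
have mt : measurable_fun [set: R] (fun x : R => x + t) by exact: measurable_funD.
have me : measurable_fun [set: R] (fun x : R => (expR (t * x - t ^+ 2 / 2))%:E).
  apply/measurable_EFinP; apply: measurableT_comp => //.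
  by apply: measurable_funB => //; exact: measurable_funM.
rewrite ge0_integral_normal_prob//; last exact: (measurableT_comp mf mt).
rewrite ge0_integral_normal_prob//; last 2 first.
- exact: emeasurable_funM.
- by move=> x; rewrite mule_ge0// lee_fin expR_ge0.
rewrite -(@ge0_integral_translation R
  (fun x => f x * (expR (t * x - t ^+ 2 / 2))%:E * (normal_pdf 0 1 x)%:E)%E t).
- apply: eq_integral => x _; rewrite -muleA -EFinM; congr (_ * (_)%:E)%E.
  by rewrite -normal_pdf01_translation addrK.
- apply: emeasurable_funM; first exact: emeasurable_funM.
  by apply/measurable_EFinP; exact: measurable_normal_pdf.
- by move=> x; rewrite !mule_ge0 ?lee_fin ?expR_ge0 ?normal_pdf_ge0.
Qed.

Section cameron_martin_finite.
Context d (Omega : measurableType d) (R : realType) (Q : probability Omega R).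
Variables (k : nat) (xi : 'I_k -> {RV Q >-> R}).
Hypothesis iid_xi : iid_std_normal xi.

Let vec w : k.-tuple R := [tuple xi i w | i < k].

Let measurable_vec : measurable_fun setT vec.
Proof. by apply: measurable_mktuple => i. Qed.

Definition resample (j : 'I_k) (v : k.-tuple R) (y : R) : k.-tuple R :=
  [tuple if i == j then y else tnth v i | i < k].

Lemma measurable_resample d1 (T : measurableType d1) j
    (V : T -> k.-tuple R) (Y : T -> R) :
  measurable_fun setT V -> measurable_fun setT Y ->
  measurable_fun setT (fun p => resample j (V p) (Y p)).
Proof.
move=> mV mY; apply: measurable_mktuple => i; case: (i == j) => //.
exact: (measurableT_comp (measurable_tnth i) mV).
Qed.

(* Independence enters only here: replacing one coordinate by an independent
   copy does not change the law, since both laws agree on rectangles. *)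
Lemma resample_law j A : measurable A ->
  Q (vec @^-1` A) =
  (Q \x normal_prob 0 1)%E ((fun p => resample j (vec p.1) p.2) @^-1` A).
Proof.
apply: (eq_law_pi_system _ _ (measurable_rectangles R k)) => //.
- exact: (measurable_resample j (measurableT_comp measurable_vec measurable_fst) measurable_snd).
- move=> _ _ [B mB ->] [C mC ->]; rewrite rectangleI.
  by exists (fun i => B i `&` C i) => // i; exact: measurableI.
- by exists (fun=> setT) => //; apply/seteqP; split.
- by rewrite [ltLHS](@probability_setT _ _ _ Q) ltry.
move=> _ [B mB ->].
have -> : vec @^-1` rectangle B = [set w | forall i, B i (xi i w)].
  by apply/seteqP; split=> w /= wB i; have := wB i; rewrite tnth_mktuple.
pose C i := if i == j then setT else B i.
have mC i : measurable (C i) by rewrite /C; case: ifP.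
have -> : (fun p => resample j (vec p.1) p.2) @^-1` rectangle B =
    [set w | forall i, C i (xi i w)] `*` B j.
  apply/seteqP; split=> [[w y]/= wB|[w y]/= [wC yB] i].
    split; last by have := wB j; rewrite tnth_mktuple eqxx.
    by move=> i; rewrite /C; have := wB i; rewrite !tnth_mktuple; case: ifP.
  by have := wC i; rewrite !tnth_mktuple /C; case: eqP => [->|].
have mCxi : measurable [set w | forall i, C i (xi i w)].
  rewrite (_ : [set _ | _] = vec @^-1` rectangle C).
    by rewrite -[X in measurable X]setTI; apply: measurable_vec => //; exact: measurable_rectangle.
  by apply/seteqP; split=> w /= wB i; have := wB i; rewrite tnth_mktuple.
rewrite [RHS]product_measure1E; [|exact: mCxi|exact: mB].
rewrite [LHS](iid_xi mB) [X in _ = (X * _)%E](iid_xi mC) (bigD1 j)//= [in RHS](bigD1 j)//= muleC.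
rewrite {1}/C eqxx [X in (X * _ * _)%E](@probability_setT _ _ _ (normal_prob 0 1)) mul1e.
by congr (_ * _)%E; apply: eq_bigr => i ij; rewrite /C (negbTE ij).
Qed.

(** Once coordinate [j] is replaced by an independent copy, the inner integral runs over that copy
    alone with the other coordinates frozen, and the one-dimensional translation formula applies to
    it. *)
Lemma cameron_martin_coordinate j (t : R) (f : k.-tuple R -> \bar R) :
  measurable_fun setT f -> (forall x, 0 <= f x)%E ->
  (\int[Q]_w f (resample j (vec w) (xi j w + t)) =
   \int[Q]_w (f (vec w) * (expR (t * xi j w - t ^+ 2 / 2))%:E))%E.
Proof.
move=> mf f0.
pose F v := f (resample j v (tnth v j + t)).
pose G v := (f v * (expR (t * tnth v j - t ^+ 2 / 2))%:E)%E.
have mj : measurable_fun setT (fun v : k.-tuple R => tnth v j) by exact: measurable_tnth.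
have mF : measurable_fun setT F.
  apply: (measurableT_comp mf); apply: measurable_resample => //.
  exact: measurable_funD.
have mG : measurable_fun setT G.
  apply: emeasurable_funM => //; apply/measurable_EFinP.
  apply: measurableT_comp => //.
  by apply: measurable_funB => //; exact: measurable_funM.
have F0 v : (0 <= F v)%E by exact: f0.
have G0 v : (0 <= G v)%E by rewrite mule_ge0// lee_fin expR_ge0.
(* [normal_prob] lives on [measurableTypeR R], whose display is not that of [R]. *)
pose GR := measurableTypeR R.
have msnd : measurable_fun [set: Omega * GR] (snd : Omega * GR -> R).
  exact: measurable_snd.
have mr : measurable_fun [set: Omega * GR] (fun p => resample j (vec p.1) p.2).
  exact: (measurable_resample j (measurableT_comp measurable_vec measurable_fst) msnd).
transitivity (\int[Q]_w F (vec w))%E.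
  by apply: eq_integral => w _; rewrite /F tnth_mktuple.
transitivity (\int[Q]_w G (vec w))%E; last first.
  by apply: eq_integral => w _; rewrite /G tnth_mktuple.
have resampling H : measurable_fun setT H -> (forall v, 0 <= H v)%E ->
    (\int[Q]_w H (vec w) =
     \int[Q]_w \int[normal_prob 0 1]_y H (resample j (vec w) y))%E.
  move=> mH H0.
  rewrite (@ge0_integral_eq_law _ _ _ _ _ _ R Q (Q \x normal_prob 0 1)%E
    _ _ _ measurable_vec mr (resample_law j) mH H0).
  apply: (fubini_tonelli1 (fun p : Omega * GR => H (resample j (vec p.1) p.2))) => //.
  exact: (measurableT_comp mH mr).
rewrite (resampling F mF F0) (resampling G mG G0).
apply: eq_integral => w _.
have E y : resample j (resample j (vec w) y) (tnth (resample j (vec w) y) j + t)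
    = resample j (vec w) (y + t).
  by apply: eq_from_tnth => i; rewrite !tnth_mktuple eqxx; case: eqP.
under eq_integral do rewrite /F E.
have mg : measurable_fun setT (fun y => f (resample j (vec w) y)).
  apply: (measurableT_comp mf); apply: measurable_resample => //.
apply: etrans (ge0_integral_normal_translation t mg (fun=> f0 _)) _.
by apply: eq_integral => y _; rewrite /G tnth_mktuple eqxx.
Qed.

(** Induction on the number [m] of translated coordinates, with [f] general because translating one
    more coordinate changes the integrand. *)
Lemma cameron_martin_vector (a : 'I_k -> R) (f : k.-tuple R -> \bar R) :
  measurable_fun setT f -> (forall x, 0 <= f x)%E ->
  (\int[Q]_w f [tuple (xi i w + a i)%R | i < k] =
   \int[Q]_w (f (vec w) *
     (expR (\sum_(i < k) a i * xi i w - (\sum_(i < k) a i ^+ 2) / 2)%R)%:E))%E.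
Proof.
pose sh m v : k.-tuple R := [tuple tnth v i + (if (i < m)%N then a i else 0) | i < k].
pose E m (v : k.-tuple R) :=
  expR (\sum_(i < k | (i < m)%N) (a i * tnth v i - a i ^+ 2 / 2)).
suff CM m : (m <= k)%N -> forall f, measurable_fun setT f -> (forall x, 0 <= f x)%E ->
    (\int[Q]_w f (sh m (vec w)) = \int[Q]_w (f (vec w) * (E m (vec w))%:E))%E.
  move=> mf f0; have := CM k (leqnn k) f mf f0.
  under eq_integral => w _.
    rewrite (_ : sh k (vec w) = [tuple xi i w + a i | i < k]); last first.
      by apply: eq_from_tnth => i; rewrite !tnth_mktuple ltn_ord.
    over.
  move=> ->; apply: eq_integral => w _; rewrite /E.
  congr (_ * (expR _)%:E)%E; rewrite mulr_suml -sumrB.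
  by apply: eq_big => i; rewrite ?ltn_ord// tnth_mktuple.
elim: m => [_|m IH mk] {}f mf f0.
  apply: eq_integral => w _; rewrite /E big_pred0// expR0 mule1.
  by congr f; apply: eq_from_tnth => i; rewrite !tnth_mktuple addr0.
pose j := Ordinal mk.
have mj i : measurable_fun setT (fun v : k.-tuple R => tnth v i) by exact: measurable_tnth.
pose f' v := f (resample j v (tnth v j + a j)).
have mf' : measurable_fun setT f'.
  apply: (measurableT_comp mf); apply: measurable_resample => //.
  exact: measurable_funD.
transitivity (\int[Q]_w f' (sh m (vec w)))%E.
  apply: eq_integral => w _; congr f; apply: eq_from_tnth => i.
  rewrite !tnth_mktuple -val_eqE/= ltnS leq_eqVlt ltnn.
  case: eqP => [im|//]; have -> : i = j by apply: val_inj.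
  by rewrite addr0.
rewrite IH; [|exact: ltnW|exact: mf'|move=> x; exact: f0].
have mE : measurable_fun setT (E m).
  apply: measurableT_comp => //.
  under eq_fun do rewrite big_mkcond.
  apply: measurable_sum => i; case: (i < m)%N => //.
  by apply: measurable_funB => //; apply: measurable_funM.
(* The weight [E m] involves only coordinates below [m], so overwriting coordinate [j] leaves it
   unchanged and it can be absorbed into the integrand. *)
pose f2 v := (f v * (E m v)%:E)%E.
transitivity (\int[Q]_w f2 (resample j (vec w) (xi j w + a j)))%E.
  apply: eq_integral => w _; rewrite /f2 /f' tnth_mktuple.
  congr (_ * (expR _)%:E)%E; apply: eq_bigr => i im; rewrite tnth_mktuple.
  case: (i =P j) => ij; first by move: im; rewrite ij /= ltnn.
  by rewrite tnth_mktuple (introF eqP ij) tnth_mktuple.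
rewrite (@cameron_martin_coordinate j (a j) f2); last 2 first.
- by apply: emeasurable_funM => //; exact/measurable_EFinP.
- by move=> v; rewrite mule_ge0// lee_fin expR_ge0.
apply: eq_integral => w _; rewrite /f2 -muleA -EFinM -expRD.
congr (_ * (expR _)%:E)%E; rewrite [RHS](bigD1 j)//= addrC.
rewrite tnth_mktuple; congr (_ + _); apply: eq_bigl => i.
by rewrite -val_eqE/= ltnS ltn_neqAle andbC.
Qed.

End cameron_martin_finite.

(** * Linear forms in independent standard normals *)

Section gaussian_linear_form.
Context d (Omega : measurableType d) (R : realType) (Q : probability Omega R).
Variables (k : nat) (xi : 'I_k -> {RV Q >-> R}).
Hypothesis iid_xi : iid_std_normal xi.
Implicit Types a b : 'I_k -> R.

Definition linear_form a (w : Omega) : R := \sum_(i < k) a i * xi i w.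

Lemma measurable_linear_form a : measurable_fun setT (linear_form a).
Proof. by apply: measurable_sum => i; exact: measurable_funM. Qed.

(** Translating the vector along [a] itself makes the Cameron-Martin exponent a function of the
    linear form alone. *)
Lemma linear_form_translation a (t : R) (f : R -> \bar R) :
  measurable_fun setT f -> (forall x, 0 <= f x)%E ->
  (\int[Q]_w f (linear_form a w + t * \sum_(i < k) a i ^+ 2)%R =
   \int[Q]_w (f (linear_form a w) *
    (expR (t * linear_form a w - t ^+ 2 * (\sum_(i < k) a i ^+ 2) / 2)%R)%:E))%E.
Proof.
move=> mf f0.
pose F (v : k.-tuple R) := f (\sum_(i < k) a i * tnth v i).
have mF : measurable_fun setT F.
  apply: (measurableT_comp mf); apply: measurable_sum => i.
  by apply: measurable_funM => //; exact: measurable_tnth.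
have F0 v : (0 <= F v)%E by exact: f0.
have := cameron_martin_vector iid_xi (fun i => t * a i) mF F0.
rewrite /F => CM; transitivity (\int[Q]_w
    F [tuple (xi i w + t * a i)%R | i < k])%E.
  apply: eq_integral => w _; congr f.
  rewrite mulr_sumr -big_split/=; apply: eq_bigr => i _.
  by rewrite tnth_mktuple; ring.
rewrite /F CM; apply: eq_integral => w _; congr (f _ * (expR _)%:E)%E.
  by apply: eq_bigr => i _; rewrite tnth_mktuple.
congr (_ - _ / 2).
  by rewrite mulr_sumr; apply: eq_bigr => i _; rewrite mulrA.
by rewrite mulr_sumr; apply: eq_bigr => i _; rewrite exprMn.
Qed.

(* Integrating the translation identity over all translations yields the law. *)
Lemma ge0_integral_linear_form a (s : R) (f : R -> \bar R) :
  0 < s -> \sum_(i < k) a i ^+ 2 = s ^+ 2 ->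
  measurable_fun setT f -> (forall x, 0 <= f x)%E ->
  (\int[Q]_w f (linear_form a w) = \int[normal_prob 0 s]_x f x)%E.
Proof.
move=> s0 as2 mf f0.
have sn0 : s != 0 by rewrite gt_eqF.
have mY := measurable_linear_form a.
pose g x := (f x * (normal_pdf 0 s x)%:E)%E.
have mpdf : measurable_fun setT (normal_pdf 0 s) by exact: measurable_normal_pdf.
have mg : measurable_fun setT g.
  by apply: emeasurable_funM => //; exact/measurable_EFinP.
have g0 x : (0 <= g x)%E by rewrite mule_ge0// lee_fin normal_pdf_ge0.
pose GR := measurableTypeR R.
have msnd : measurable_fun [set: Omega * GR] (snd : Omega * GR -> R).
  exact: measurable_snd.
have mYfst : measurable_fun [set: Omega * GR] (fun p => linear_form a p.1).
  exact: (measurableT_comp mY measurable_fst).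
(* The exponential weight turns the N(0, s^2) density at Y into the N(Y, s^2) density at [u], whose
   integral over [u] is 1. *)
have E1 u : (\int[Q]_w g (linear_form a w + u)%R =
    \int[Q]_w (f (linear_form a w) * (normal_pdf (linear_form a w) s u)%:E))%E.
  have := linear_form_translation a (u / s ^+ 2) mg g0.
  have us2 : u / s ^+ 2 * s ^+ 2 = u by rewrite divfK ?expf_neq0.
  rewrite as2 us2 => CM; apply: etrans CM _.
  apply: eq_integral => w _; rewrite -muleA -EFinM; congr (_ * (_)%:E)%E.
  rewrite !normal_pdfE// /normal_fun -[_ * expR _ * expR _]mulrA -expRD.
  congr (_ * expR _).
  by rewrite subr0; field.
rewrite ge0_integral_normal_prob// -/g; apply/esym.
transitivity (\int[Q]_w \int[lebesgue_measure]_u g (linear_form a w + u)%R)%E.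
  transitivity (\int[Q]_w \int[lebesgue_measure]_u g u)%E; last first.
    apply: eq_integral => w _.
    rewrite -(ge0_integral_translation (linear_form a w) mg g0).
    by apply: eq_integral => u _; rewrite addrC.
  by rewrite integral_cst// [X in (_ * X)%E](@probability_setT _ _ _ Q) mule1.
transitivity (\int[lebesgue_measure]_u \int[Q]_w g (linear_form a w + u)%R)%E.
  apply: (fubini_tonelli (fun p : Omega * GR => g (linear_form a p.1 + p.2))) => //.
  by apply: (measurableT_comp mg); exact: measurable_funD.
under eq_integral do rewrite E1.
transitivity (\int[Q]_w \int[lebesgue_measure]_u
   (f (linear_form a w) * (normal_pdf (linear_form a w) s u)%:E))%E.
  apply/esym.
  apply: (fubini_tonelli (fun p : Omega * GR =>
    f (linear_form a p.1) * (normal_pdf (linear_form a p.1) s p.2)%:E)%E) => //=.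
    apply: emeasurable_funM; first exact: (measurableT_comp mf).
    apply/measurable_EFinP.
    rewrite (_ : (fun _ => _) = (fun p : Omega * GR => normal_pdf 0 s (p.2 - linear_form a p.1))).
      by apply: (measurableT_comp mpdf); exact: measurable_funB.
    by apply/funext => p; rewrite !normal_pdfE// /normal_fun subr0.
  by move=> p; rewrite mule_ge0// lee_fin normal_pdf_ge0.
apply: eq_integral => w _; rewrite ge0_integralZl//.
- by rewrite integral_normal_pdf mule1.
- by apply/measurable_EFinP; exact: measurable_normal_pdf.
- by move=> x _; rewrite lee_fin normal_pdf_ge0.
Qed.

Lemma linear_form_law a (s : R) A : 0 < s ->
  \sum_(i < k) a i ^+ 2 = s ^+ 2 -> measurable A ->
  Q (linear_form a @^-1` A) = normal_prob 0 s A.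
Proof.
move=> s0 as2 mA.
have mYA : measurable (linear_form a @^-1` A).
  by rewrite -[X in measurable X]setTI; exact: measurable_linear_form.
have <- : (\int[normal_prob 0 s]_x (\1_A x)%:E = normal_prob 0 s A)%E.
  by rewrite integral_indic// setIT.
have <- : (\int[Q]_w (\1_(linear_form a @^-1` A) w)%:E =
    Q (linear_form a @^-1` A))%E by rewrite integral_indic// setIT.
rewrite -(ge0_integral_linear_form s0 as2 (f := fun x => (\1_A x)%:E))//.
by apply/measurable_EFinP; exact: measurable_indic.
Qed.

Let second_moment a := (\int[Q]_w (linear_form a w ^+ 2)%:E)%E.

(* The exponent is chosen so that the weight turns the N(0, s^2) density into
   rho times the N(0, (rho s)^2) density. *)
Let integral_expR_sqr a (s rho : R) : 0 < s -> 0 < rho ->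
  \sum_(i < k) a i ^+ 2 = s ^+ 2 ->
  (\int[Q]_w (expR ((1 - (rho ^+ 2)^-1) / (2 * s ^+ 2) * linear_form a w ^+ 2))%:E
   = rho%:E)%E.
Proof.
move=> s0 r0 as2.
have sn0 : s != 0 by rewrite gt_eqF.
have rn0 : rho != 0 by rewrite gt_eqF.
have rsn0 : rho * s != 0 by rewrite mulf_neq0.
set c := _ / _.
have mE : measurable_fun [set: R] (fun y : R => (expR (c * y ^+ 2))%:E).
  apply/measurable_EFinP; apply: measurableT_comp => //.
  by apply: measurable_funM => //; exact: measurable_funX.
have e0 y : (0 <= (expR (c * y ^+ 2))%:E)%E by rewrite lee_fin expR_ge0.
rewrite (ge0_integral_linear_form s0 as2 mE e0) (ge0_integral_normal_prob _ _ mE e0).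
transitivity (\int[lebesgue_measure]_y (rho%:E * (normal_pdf 0 (rho * s) y)%:E))%E.
  apply: eq_integral => y _; rewrite -!EFinM !normal_pdfE//; congr EFin.
  rewrite mulrCA [RHS]mulrA /normal_fun -expRD; congr (_ * expR _); last first.
    by rewrite /c; field; rewrite sn0 rn0.
  rewrite /normal_peak; have -> : (rho * s) ^+ 2 * pi *+ 2 = rho ^+ 2 * (s ^+ 2 * pi *+ 2).
    by rewrite exprMn -mulrA mulrnAr.
  rewrite (sqrtrM _ (sqr_ge0 rho)) sqrtr_sqr.
  by rewrite gtr0_norm// invfM mulrA divff// mul1r.
rewrite ge0_integralZl//.
- by rewrite integral_normal_pdf mule1.
- by apply/measurable_EFinP; exact: measurable_normal_pdf.
- by move=> x _; rewrite lee_fin normal_pdf_ge0.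
- by rewrite lee_fin ltW.
Qed.

Lemma linear_form0 a : \sum_(i < k) a i ^+ 2 = 0 -> linear_form a = cst 0.
Proof.
move=> a0; apply/funext => w; rewrite /linear_form big1//= => i _.
have := @psumr_eq0P R 'I_k predT (fun i => a i ^+ 2) (fun i _ => sqr_ge0 (a i)) a0 i isT.
by move/eqP; rewrite sqrf_eq0 => /eqP ->; rewrite mul0r.
Qed.

Let sqrt_sum_sqr a : \sum_(i < k) a i ^+ 2 != 0 ->
  exists2 s : R, 0 < s & \sum_(i < k) a i ^+ 2 = s ^+ 2.
Proof.
move=> a0; have S0 : 0 <= \sum_(i < k) a i ^+ 2 by apply: sumr_ge0 => i _; exact: sqr_ge0.
exists (Num.sqrt (\sum_(i < k) a i ^+ 2)); last by rewrite sqr_sqrtr.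
by rewrite sqrtr_gt0 lt_neqAle eq_sym a0.
Qed.

(* With c as in [integral_expR_sqr], 1 + c E Y^2 <= E exp (c Y^2) = rho for every
   rho > 0; letting rho tend to 1 from either side pins down E Y^2. *)
Lemma integral_sqr_linear_form a :
  (\int[Q]_w (linear_form a w ^+ 2)%:E = (\sum_(i < k) a i ^+ 2)%:E)%E.
Proof.
have [a0|/sqrt_sum_sqr[s s0 as2]] := eqVneq (\sum_(i < k) a i ^+ 2) 0.
  rewrite a0 (linear_form0 a0).
  by under eq_integral do rewrite expr0n/=; rewrite integral0.
have mY2 : measurable_fun setT (fun w => (linear_form a w ^+ 2)%:E).
  apply/measurable_EFinP; apply: measurable_funX; exact: measurable_linear_form.
pose c (rho : R) := (1 - (rho ^+ 2)^-1) / (2 * s ^+ 2).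
have mexp (r : R) : measurable_fun setT (fun w => (expR (r * linear_form a w ^+ 2))%:E).
  apply/measurable_EFinP; apply: measurableT_comp => //.
  by apply: measurable_funM => //; apply: measurable_funX; exact: measurable_linear_form.
have Y20 w : (0 <= (linear_form a w ^+ 2)%:E)%E by rewrite lee_fin sqr_ge0.
pose m := second_moment a.
have m0 : (0 <= m)%E by apply: integral_ge0.
have int1 : (\int[Q]_w 1 = 1 :> \bar R)%E.
  by rewrite integral_cst// mul1e [LHS](@probability_setT _ _ _ Q).
have up rho : 1 < rho -> (1 + (c rho)%:E * m <= rho%:E)%E.
  move=> r1; have r0 : 0 < rho by rewrite (lt_trans ltr01).
  have c0 : 0 <= c rho.
    apply: divr_ge0; last by rewrite mulr_ge0 ?sqr_ge0.
    by rewrite subr_ge0 invf_le1 ?exprn_gt0// exprn_ege1// ltW.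
  rewrite -(integral_expR_sqr s0 r0 as2) -/(c rho) -int1.
  rewrite -ge0_integralZl// -ge0_integralD//; last 2 first.
  - by move=> w _; rewrite mule_ge0.
  - exact: measurable_funeM.
  apply: ge0_le_integral => //.
  - by move=> w _; rewrite adde_ge0// mule_ge0.
  - by apply: emeasurable_funD => //; exact: measurable_funeM.
  - by move=> w _; rewrite -EFinM -EFinD lee_fin expR_ge1Dx.
have lo rho : 0 < rho -> rho <= 1 -> (1 <= rho%:E + (- c rho)%:E * m)%E.
  move=> r0 r1.
  have c0 : 0 <= - c rho.
    rewrite /c -mulNr; apply: divr_ge0; last by rewrite mulr_ge0 ?sqr_ge0.
    by rewrite opprB subr_ge0 invf_ge1 ?exprn_gt0// exprn_ile1// ltW.
  rewrite -(integral_expR_sqr s0 r0 as2) -/(c rho) -int1.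
  rewrite -ge0_integralZl// -ge0_integralD//; last 2 first.
  - by move=> w _; rewrite mule_ge0.
  - exact: measurable_funeM.
  apply: ge0_le_integral => //.
  - by apply: emeasurable_funD => //; exact: measurable_funeM.
  - move=> w _; rewrite -EFinM -EFinD lee_fin mulNr lerBrDr.
    exact: expR_ge1Dx.
rewrite as2 -/(second_moment a) -/m.
have s20 : 0 < s ^+ 2 by rewrite exprn_gt0.
(* A single [rho] with [c rho > 0] rules out an infinite second moment; 2 will do. *)
have mfin : m \is a fin_num.
  have h : 0 < c 2.
    by rewrite /c divr_gt0 ?mulr_gt0// subr_gt0 invf_lt1; lra.
  rewrite ge0_fin_numE//; have := up 2 (ltr1n _ 2).
  case: (m) m0 => [r _ _|_|//]; first exact: ltry.
  by rewrite gt0_muley ?lte_fin.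
move: up lo; rewrite -(fineK mfin); set mu := fine m => up lo; congr EFin.
have {}up rho : 1 < rho -> mu <= s ^+ 2 * rho ^+ 2.
  move=> r1; have := up rho r1; rewrite -EFinM -EFinD lee_fin -lerBrDl /c.
  have r0 : 0 < rho by lra.
  have r20 : 0 < rho ^+ 2 by rewrite exprn_gt0.
  have -> : (1 - (rho ^+ 2)^-1) / (2 * s ^+ 2) * mu =
      (rho - 1) * ((rho + 1) * mu / (2 * s ^+ 2 * rho ^+ 2)).
    by field; rewrite !gt_eqF.
  rewrite -[leRHS]mulr1 ler_pM2l ?subr_gt0// ler_pdivrMr ?mulr_gt0// mul1r.
  have mu0 : 0 <= mu by rewrite fine_ge0.
  nra.
have {}lo rho : 0 < rho -> rho < 1 -> s ^+ 2 * rho ^+ 2 <= mu.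
  move=> r0 r1; have := lo rho r0 (ltW r1); rewrite -EFinM -EFinD lee_fin -lerBlDl /c.
  have r20 : 0 < rho ^+ 2 by rewrite exprn_gt0.
  have -> : - ((1 - (rho ^+ 2)^-1) / (2 * s ^+ 2)) * mu =
      (1 - rho) * ((rho + 1) * mu / (2 * s ^+ 2 * rho ^+ 2)).
    by field; rewrite !gt_eqF.
  rewrite -[leLHS]mulr1 ler_pM2l ?subr_gt0// ler_pdivlMr ?mulr_gt0// mul1r.
  have mu0 : 0 <= mu by rewrite fine_ge0.
  nra.
pose q := mu / s ^+ 2.
have muE : mu = s ^+ 2 * q by rewrite /q mulrC divfK// gt_eqF.
have q0 : 0 <= q by rewrite divr_ge0 ?fine_ge0// ltW.
suff q1 : q = 1 by rewrite muE q1 mulr1.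
have {}up rho : 1 < rho -> q <= rho ^+ 2.
  by move=> /up; rewrite muE ler_pM2l.
have {}lo rho : 0 < rho -> rho < 1 -> rho ^+ 2 <= q.
  by move=> r0 /(lo _ r0); rewrite muE ler_pM2l.
(* For q < 1 take as [rho] the arithmetic mean of q and 1, whose square exceeds q; for q > 1 take
   their harmonic mean, whose square is below q. *)
case: (ltgtP q 1) => // q1.
  by have := lo ((q + 1) / 2); nra.
have q10 : 0 < q + 1 by lra.
have : q <= (2 * q / (q + 1)) ^+ 2 by apply: up; rewrite ltr_pdivlMr//; lra.
rewrite expr_div_n ler_pdivlMr ?exprn_gt0// => h.
have : 0 < q * (q - 1) ^+ 2 by rewrite mulr_gt0 ?exprn_gt0 ?subr_gt0//; lra.
lra.
Qed.

Lemma linear_formD a b w :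
  linear_form (fun i => a i + b i) w = linear_form a w + linear_form b w.
Proof. by rewrite -big_split; apply: eq_bigr => i _; rewrite mulrDl. Qed.

Lemma linear_formN a w : linear_form (fun i => - a i) w = - linear_form a w.
Proof. by rewrite -sumrN; apply: eq_bigr => i _; rewrite mulNr. Qed.

Lemma Lfun2_linear_form a : linear_form a \in Lfun Q 2%:E.
Proof.
apply/andP; split; first by rewrite inE; exact: measurable_linear_form.
rewrite inE /= /finite_norm unlock /Lnorm; apply: poweR_lty.
under eq_integral do rewrite /= powR_mulrn// -normrX ger0_norm ?sqr_ge0//.
by rewrite integral_sqr_linear_form ltry.
Qed.

(** By symmetry: [a] and its opposite have the same sum of squares, so the two forms have the same
    law and opposite expectations. *)
Lemma expectation_linear_form a : ('E_Q[linear_form a] = 0)%E.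
Proof.
have [a0|/sqrt_sum_sqr[s s0 as2]] := eqVneq (\sum_(i < k) a i ^+ 2) 0.
  by rewrite (linear_form0 a0) expectation_cst.
have Nas2 : \sum_(i < k) (- a i) ^+ 2 = s ^+ 2.
  by rewrite -as2; apply: eq_bigr => i _; rewrite sqrrN.
have L1 : linear_form a \in Lfun Q 1.
  by apply: Lfun_subset12; [exact: fin_num_measure|exact: Lfun2_linear_form].
have : ('E_Q[linear_form a] = 'E_Q[linear_form (fun i => (- a i)%R)])%E.
  rewrite unlock.
  apply: (integral_eq_law (measurable_linear_form a)
    (measurable_linear_form (fun i => - a i)) (f := EFin)) => // A mA.
  exact: etrans (linear_form_law s0 as2 mA) (esym (linear_form_law s0 Nas2 mA)).
have -> : linear_form (fun i => - a i) = (-1) \o* linear_form a.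
  by apply/funext => w; rewrite linear_formN/= mulrN1.
rewrite expectationZl// -(fineK (expectation_fin_num L1)) -EFinM => -[] h.
by congr EFin; lra.
Qed.

(** Polarization reduces this to the second moments for a + b and a - b. *)
Lemma integral_linear_formM a b :
  (\int[Q]_w (linear_form a w * linear_form b w)%:E =
   (\sum_(i < k) a i * b i)%:E)%E.
Proof.
pose p i := a i + b i; pose m i := a i + - b i.
have sqr_int c : Q.-integrable setT (fun w => (linear_form c w ^+ 2)%:E).
  exact: Lfun2_integrable_sqr (Lfun2_linear_form c).
have E w : ((linear_form a w * linear_form b w)%:E =
    4^-1%:E * ((linear_form p w ^+ 2)%:E - (linear_form m w ^+ 2)%:E))%E.
  rewrite -EFinB -EFinM; congr EFin.
  by rewrite /p /m !linear_formD linear_formN; field.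
under eq_integral do rewrite E.
rewrite integralZl//; last exact: integrableB.
rewrite integralB// !integral_sqr_linear_form -EFinB -EFinM; congr EFin.
by rewrite -sumrB mulr_sumr; apply: eq_bigr => i _; rewrite /p /m; field.
Qed.

End gaussian_linear_form.

(** * The Cameron-Martin formula for an isonormal process *)

Section isonormal_process.
Context d (X : measurableType d) (R : realType) (P : probability X R).
Context d' (Omega : measurableType d') (Q : probability Omega R).
Variables (K : set (L2 P)) (Delta : K -> {RV Q >-> R}).
Hypothesis iso : isonormal Delta.

(** The Gaussian hypothesis supplies some matrix [A], and the covariance hypothesis prescribes the
    Gram matrix. Computing the covariance on both spaces identifies the products of rows of [A] with
    [l2dot]; the means come first because [covariance] centres its arguments. *)
Lemma isonormal_representation n (g : 'I_n -> K) :
  exists k (A : 'I_n -> 'I_k -> R) d1 (Om' : measurableType d1)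
    (Q' : probability Om' R) (xi : 'I_k -> {RV Q' >-> R}),
    [/\ iid_std_normal xi,
        forall B : set (n.-tuple R), measurable B ->
          Q ((fun w => [tuple Delta (g i) w | i < n]) @^-1` B) =
          Q' ((fun w => [tuple linear_form xi (A i) w | i < n]) @^-1` B)
      & forall i l, l2dot (val (g i)) (val (g l)) = \sum_(j < k) A i j * A l j].
Proof.
have [gauss cov] := iso.
have [k [A [d1 [Om' [Q' [xi [iid law]]]]]]] := gauss n g.
exists k, (fun i j => A i j), d1, Om', Q', xi; split=> //.
have mDelta : measurable_fun setT (fun w => [tuple Delta (g i) w | i < n]).
  by apply: measurable_mktuple.
have mform : measurable_fun setT
    (fun w => [tuple linear_form xi (fun j => A i j) w | i < n]).
  by apply: measurable_mktuple => i; exact: measurable_linear_form.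
have mt (i : 'I_n) : measurable_fun setT (fun v : n.-tuple R => tnth v i).
  exact: measurable_tnth.
have mean i : ('E_Q[Delta (g i)] = 0)%E.
  rewrite -(expectation_linear_form iid (fun j => A i j)) unlock.
  transitivity (\int[Q]_w
      ((fun v : n.-tuple R => (tnth v i)%:E) [tuple Delta (g i) w | i < n]))%E.
    by apply: eq_integral => w _; rewrite tnth_mktuple.
  rewrite (integral_eq_law mDelta mform law (f := fun v => (tnth v i)%:E)).
    by apply: eq_integral => w _; rewrite tnth_mktuple.
  exact/measurable_EFinP.
move=> i l; apply/EFin_inj; rewrite -cov.
rewrite -(integral_linear_formM iid) [in LHS]unlock !mean /= unlock.
transitivity (\int[Q]_w
    ((fun v : n.-tuple R => (tnth v i * tnth v l)%:E) [tuple Delta (g i) w | i < n]))%E.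
  apply: eq_integral => w _ /=; rewrite !tnth_mktuple; congr EFin.
  by rewrite -[LHS]/((Delta (g i) w - 0) * (Delta (g l) w - 0)) !subr0.
rewrite (integral_eq_law mDelta mform law (f := fun v : n.-tuple R => (tnth v i * tnth v l)%:E)).
  by apply: eq_integral => w _; rewrite !tnth_mktuple.
by apply/measurable_EFinP; exact: measurable_funM.
Qed.

Lemma isonormal_law (h : K) (s : R) B : 0 < s ->
  l2dot (val h) (val h) = s ^+ 2 -> measurable B ->
  Q (Delta h @^-1` B) = normal_prob 0 s B.
Proof.
move=> s0 hs mB.
have [k [A [d1 [Om' [Q' [xi [iid law cov]]]]]]] :=
  isonormal_representation (fun _ : 'I_1 => h).
have Es : \sum_(j < k) A ord0 j ^+ 2 = s ^+ 2.
  by rewrite -hs (cov ord0 ord0); apply: eq_bigr => j _.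
rewrite -(linear_form_law iid s0 Es mB).
have := law [set v | B (tnth v ord0)].
rewrite (_ : _ @^-1` _ = Delta h @^-1` B); last first.
  by apply/seteqP; split=> w /=; rewrite tnth_mktuple.
rewrite (_ : _ @^-1` _ = linear_form xi (A ord0) @^-1` B); last first.
  by apply/seteqP; split=> w /=; rewrite tnth_mktuple.
apply; rewrite -[X in measurable X]setTI.
by apply: (measurable_tnth ord0).
Qed.

Lemma cameron_martin_tuple (h : K) n (g : 'I_n -> K) (B : set (n.-tuple R)) :
  measurable B ->
  Q [set w | B [tuple Delta (g i) w + l2dot (val h) (val (g i)) | i < n]] =
  (\int[Q]_(w in [set w | B [tuple Delta (g i) w | i < n]])
     (expR (Delta h w - l2dot (val h) (val h) / 2))%:E)%E.
Proof.
move=> mB.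
(* Adjoining h to the family makes its row of A the shift of the Gaussian vector. *)
pose g' i := oapp g h (unlift ord0 i).
have [k [A [d1 [Om' [Q' [xi [iid law cov]]]]]]] := isonormal_representation g'.
have g'0 : g' ord0 = h by rewrite /g' unlift_none.
have g'S i : g' (lift ord0 i) = g i by rewrite /g' liftK.
set c := fun i => l2dot (val h) (val (g i)).
have cE i : c i = \sum_(j < k) A (lift ord0 i) j * A ord0 j.
  rewrite /c -g'S -{1}g'0 cov; apply: eq_bigr => j _; exact: mulrC.
have hE : l2dot (val h) (val h) = \sum_(j < k) A ord0 j ^+ 2.
  by rewrite -g'0 cov.
have mDelta : measurable_fun setT (fun w => [tuple Delta (g' i) w | i < n.+1]).
  by apply: measurable_mktuple.
have mform : measurable_fun setT
    (fun w => [tuple linear_form xi (A i) w | i < n.+1]).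
  by apply: measurable_mktuple => i; exact: measurable_linear_form.
have mt m (i : 'I_m) : measurable_fun setT (fun v : m.-tuple R => tnth v i).
  exact: measurable_tnth.
have mBind : measurable_fun setT (fun x : n.-tuple R => (\1_B x)%:E : \bar R).
  by apply/measurable_EFinP; exact: measurable_indic.
(* Both sides become integrals of functions of the enlarged tuple, which depend only on its law and
   so transfer to [xi]. *)
pose f (v : n.+1.-tuple R) : \bar R :=
  (\1_B [tuple tnth v (lift ord0 i) + c i | i < n])%:E.
pose f2 (v : n.+1.-tuple R) : \bar R :=
  ((\1_B [tuple tnth v (lift ord0 i) | i < n])%:E *
   (expR (tnth v ord0 - l2dot (val h) (val h) / 2))%:E)%E.
have mf : measurable_fun setT f.
  apply: (measurableT_comp mBind); apply: measurable_mktuple => i.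
  by apply: measurable_funD => //; exact: mt.
have mf2 : measurable_fun setT f2.
  apply: emeasurable_funM.
    by apply: (measurableT_comp mBind); apply: measurable_mktuple => i; exact: mt.
  apply/measurable_EFinP; apply: measurableT_comp => //.
  by apply: measurable_funB => //; exact: mt.
pose F (v : k.-tuple R) : \bar R :=
  (\1_B [tuple \sum_(j < k) A (lift ord0 i) j * tnth v j | i < n])%:E.
have mF : measurable_fun setT F.
  apply: (measurableT_comp mBind); apply: measurable_mktuple => i.
  by apply: measurable_sum => j; apply: measurable_funM => //; exact: mt.
have f0 v : (0 <= f v)%E by rewrite lee_fin.
have f20 v : (0 <= f2 v)%E by rewrite /f2 -EFinM lee_fin mulr_ge0// expR_ge0.
have F0 v : (0 <= F v)%E by rewrite lee_fin.
have mXB c' : measurable [set w | B [tuple (Delta (g i) w + c' i) | i < n]].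
  rewrite -[X in measurable X]setTI.
  apply: (measurable_mktuple (X := fun i w => Delta (g i) w + c' i)) => // i.
  exact: measurable_funD.
have inB (t : Omega -> n.-tuple R) w : (w \in [set w | B (t w)]) = (t w \in B).
  by apply/idP/idP => /set_mem ?; exact/mem_set.
have tDelta (u : 'I_n -> R) w :
    [tuple tnth [tuple Delta (g' l) w | l < n.+1] (lift ord0 i) + u i | i < n] =
    [tuple Delta (g i) w + u i | i < n].
  by apply: eq_from_tnth => i; rewrite !tnth_mktuple g'S.
have tDelta0 w :
    [tuple tnth [tuple Delta (g' l) w | l < n.+1] (lift ord0 i) | i < n] =
    [tuple Delta (g i) w | i < n].
  by apply: eq_from_tnth => i; rewrite !tnth_mktuple g'S.
transitivity (\int[Q]_w f [tuple Delta (g' i) w | i < n.+1])%E.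
  transitivity (\int[Q]_w (\1_[set w | B [tuple (Delta (g i) w + c i) | i < n]] w)%:E)%E.
    by rewrite integral_indic// setIT.
  apply: eq_integral => w _.
  by rewrite /f tDelta !indicE inB.
transitivity (\int[Q]_w f2 [tuple Delta (g' i) w | i < n.+1])%E; last first.
  rewrite [RHS]integral_mkcond; apply: eq_integral => w _.
  rewrite epatch_indic /f2 !indicE muleC tnth_mktuple g'0.
  by rewrite tDelta0 /= indicE inB.
apply: etrans (ge0_integral_eq_law mDelta mform law mf f0) _.
apply: etrans _ (esym (ge0_integral_eq_law mDelta mform law mf2 f20)).
(* By [cE], translating [xi] by the row of [h] translates the form of index [lift ord0 i] by
   [c i]. *)
transitivity (\int[Q']_w F [tuple (xi j w + A ord0 j)%R | j < k])%E.
  apply: eq_integral => w _; rewrite /f /F; congr (\1_B _)%:E.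
  apply: eq_from_tnth => i; rewrite !tnth_mktuple cE /linear_form -big_split.
  by apply: eq_bigr => j _; rewrite tnth_mktuple mulrDr.
rewrite (cameron_martin_vector iid _ mF F0).
apply: eq_integral => w _; rewrite /f2 /F tnth_mktuple hE.
congr ((\1_B _)%:E * _)%E.
apply: eq_from_tnth => i; rewrite !tnth_mktuple.
by apply: eq_bigr => j _; rewrite tnth_mktuple.
Qed.

Lemma measurable_evaluation (g : K) :
  measurable_fun [set: observation K] (fun z : observation K => z g).
Proof.
move=> _ B mB; apply: sub_sigma_algebra; exists g => //.
by exists B.
Qed.

Lemma measurable_to_observation d1 (Y : measurableType d1)
    (z : Y -> observation K) :
  (forall g, measurable_fun setT (fun y => z y g)) -> measurable_fun setT z.
Proof.
move=> mz.
have E : @measurable _ (observation K) = <<s \bigcup_(g in [set: K])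
    preimage_set_system [set: K -> R] (fun z => z g) measurable >> by [].
apply: (@measurability _ _ _ _ setT z _ E).
move=> _ [_ [g _ [B mB <-]] <-].
by rewrite setTI; apply: mz.
Qed.

Lemma measurable_shifted h : measurable_fun setT (shifted Delta h).
Proof.
by apply: measurable_to_observation => g; exact: measurable_funD.
Qed.

(** The preimages under single evaluations that define the sigma-algebra are not a pi-system.
    Conditions on finitely many evaluations are, and the finite-dimensional formula settles them. *)
Definition cylinder : set (set (observation K)) :=
  [set A | exists n (g : 'I_n -> K) (B : set (n.-tuple R)),
     measurable B /\ A = [set z : observation K | B [tuple z (g i) | i < n]]].

Lemma measurable_cylinder : @measurable _ (observation K) = <<s cylinder >>.
Proof.
apply/seteqP; split.
  apply: smallest_sub; first exact: smallest_sigma_algebra.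
  move=> _ [g _ [B mB <-]]; apply: sub_sigma_algebra.
  exists 1%N, (fun=> g), [set v | B (tnth v ord0)]; split.
    by rewrite -[X in measurable X]setTI; apply: (measurable_tnth ord0).
  by rewrite setTI; apply/seteqP; split=> z /=; rewrite tnth_mktuple.
apply: smallest_sub; first exact: sigma_algebra_measurable.
move=> _ [n [g [B [mB ->]]]]; rewrite -[X in measurable X]setTI.
apply: (measurable_mktuple (X := fun i (z : observation K) => z (g i))) => // i.
exact: measurable_evaluation.
Qed.

Lemma cylinderI : setI_closed cylinder.
Proof.
move=> _ _ [n [g [B [mB ->]]]] [m [g' [C [mC ->]]]].
pose gg (i : 'I_(n + m)) :=
  match fintype.split i with inl j => g j | inr j => g' j end.
exists (n + m)%N, gg.
exists [set v | B [tuple tnth v (lshift m i) | i < n] /\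
                C [tuple tnth v (rshift n i) | i < m]]; split.
  apply: measurableI; rewrite -[X in measurable X]setTI.
    apply: (measurable_mktuple (X := fun i (v : (n + m).-tuple R) => tnth v (lshift m i))) => // i.
    exact: measurable_tnth.
  apply: (measurable_mktuple (X := fun i (v : (n + m).-tuple R) => tnth v (rshift n i))) => // i.
  exact: measurable_tnth.
have L (z : observation K) :
    [tuple tnth [tuple z (gg i) | i < n + m] (lshift m i) | i < n] =
    [tuple z (g i) | i < n].
  apply: eq_from_tnth => i; rewrite !tnth_mktuple /gg.
  by rewrite -[lshift m i]/(unsplit (inl i)) unsplitK.
have R' (z : observation K) :
    [tuple tnth [tuple z (gg i) | i < n + m] (rshift n i) | i < m] =
    [tuple z (g' i) | i < m].
  apply: eq_from_tnth => i; rewrite !tnth_mktuple /gg.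
  by rewrite -[rshift n i]/(unsplit (inr i)) unsplitK.
by apply/seteqP; split=> z /=; rewrite L R'.
Qed.

Let sample (w : Omega) : observation K := fun g => Delta g w.

Lemma cameron_martin (h : K) A : measurable A ->
  Q (shifted Delta (val h) @^-1` A) =
  (\int[Q]_(w in sample @^-1` A)
     (expR (Delta h w - l2dot (val h) (val h) / 2))%:E)%E.
Proof.
move=> mA.
pose L w := (expR (Delta h w - l2dot (val h) (val h) / 2))%:E.
have mL : measurable_fun setT L.
  by apply/measurable_EFinP; apply: measurableT_comp => //; exact: measurable_funB.
have L0 w : (0 <= L w)%E by rewrite lee_fin expR_ge0.
have [m mE] := exists_density_measure Q mL L0.
rewrite -mE; apply: (eq_law_pi_system _ _ measurable_cylinder) => //.
- exact: measurable_shifted.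
- by apply: measurable_to_observation.
- exact: cylinderI.
(* The empty family yields the whole space as a cylinder. *)
- exists 0%N, (fun i : 'I_0 => h), setT; split => //.
- by rewrite [ltLHS](@probability_setT _ _ _ Q) ltry.
- move=> _ [n [g [B [mB ->]]]]; rewrite mE.
  exact: cameron_martin_tuple.
Qed.

End isonormal_process.

(** * Geometry of square-integrable functions *)

Section L2_geometry.
Context d (X : measurableType d) (R : realType) (P : probability X R).
Implicit Types f g h : L2 P.

Lemma L2_integrableM f g : P.-integrable setT (fun x => (f x * g x)%:E).
Proof. exact/Lfun1_integrable/(Lfun2_mul_Lfun1 (LfunP f) (LfunP g)). Qed.

Lemma l2dotE f g : (\int[P]_x (f x * g x)%:E = (l2dot f g)%:E)%E.
Proof.
by rewrite /l2dot fineK//; apply: integrable_fin_num => //; exact: L2_integrableM.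
Qed.

Lemma l2dotDl f g h : l2dot (f + g) h = l2dot f h + l2dot g h.
Proof.
apply/EFin_inj; rewrite [RHS]EFinD -!l2dotE -integralD//; [|exact: L2_integrableM..].
by apply: eq_integral => x _; rewrite -EFinD -mulrDl.
Qed.

Lemma l2dotZl (c : R) f h : l2dot (c *: f) h = c * l2dot f h.
Proof.
apply/EFin_inj; rewrite [RHS]EFinM -!l2dotE -integralZl//; last exact: L2_integrableM.
by apply: eq_integral => x _; rewrite -EFinM mulrA.
Qed.

Lemma l2dotBl f g h : l2dot (f - g) h = l2dot f h - l2dot g h.
Proof. by rewrite -scaleN1r l2dotDl l2dotZl mulN1r. Qed.

Lemma l2norm_ge0 f : 0 <= l2norm f.
Proof. by rewrite fine_ge0// Lnorm_ge0. Qed.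

Lemma sqr_l2norm f : l2norm f ^+ 2 = l2dot f f.
Proof.
rewrite -powR_mulrn ?l2norm_ge0//; apply/EFin_inj.
rewrite -poweR_EFin /l2norm finite_norm_fine powR_Lnorm// -l2dotE.
by apply: eq_integral => x _ /=; rewrite powR_mulrn// real_normK ?num_real// expr2.
Qed.

Lemma l2normZ (c : R) f : l2norm (c *: f) = `|c| * l2norm f.
Proof.
by apply/EFin_inj; rewrite [RHS]EFinM /l2norm !finite_norm_fine; exact: LnormZ.
Qed.

Lemma ler_l2normB f g : l2norm (f - g) <= l2norm f + l2norm g.
Proof. by rewrite (le_trans (ler_LnormD _ _))// lerD2l LnormrN. Qed.

End L2_geometry.

(** * Two-point bound *)

(** The density is at most its peak 1 / (s sqrt (2 pi)), and the interval has length s^2. *)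
Lemma normal_prob_half_open_le (R : realType) (s : R) : 0 < s ->
  (normal_prob 0 s `](- (s ^+ 2 / 2))%R, (s ^+ 2 / 2)%R] <=
   (s / Num.sqrt (2 * pi))%:E)%E.
Proof.
move=> s0; have sn0 : s != 0 by rewrite gt_eqF.
have s20 : 0 < s ^+ 2 by rewrite exprn_gt0.
apply: (@le_trans _ _ (\int[lebesgue_measure]_(x in `](- (s ^+ 2 / 2))%R, (s ^+ 2 / 2)%R])
    (normal_peak s)%:E)%E).
  apply: ge0_le_integral => //.
  - by move=> x _; rewrite lee_fin normal_pdf_ge0.
  - by apply/measurable_EFinP/measurable_funTS; exact: measurable_normal_pdf.
  - by move=> x _; rewrite lee_fin normal_pdf_ub.
rewrite integral_cst//= lebesgue_measure_itv/= lte_fin ifT; last by lra.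
rewrite -EFinD -EFinM lee_fin /normal_peak.
have -> : s ^+ 2 * pi *+ 2 = s ^+ 2 * (2 * pi) by rewrite -mulr_natl; ring.
rewrite sqrtrM ?sqr_ge0// sqrtr_sqr gtr0_norm// opprK -splitr invfM.
by rewrite expr2 mulrAC mulrA mulVf// mul1r mulrC.
Qed.

Section two_point.
Context d (X : measurableType d) (R : realType) (P : probability X R).
Context d' (Omega : measurableType d') (Q : probability Omega R).
Variables (K : set (L2 P)) (Delta : K -> {RV Q >-> R}).
Hypothesis iso : isonormal Delta.
Variables (h1 h2 : L2 P) (v : K).
Hypothesis vE : val v = h1 - h2.

Let s := l2norm (val v).

(** The right side will be the mass of the minimum of the two shifted laws; what is missing from 1
    is the mass of the interval between the two events. *)
Lemma isonormal_affinity :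
  ((1 - s / Num.sqrt (2 * pi))%:E <=
   Q [set w | Delta v w <= - (s ^+ 2 / 2)]%R +
   Q [set w | s ^+ 2 / 2 < Delta v w]%R)%E.
Proof.
pose c := s ^+ 2 / 2.
have c0 : 0 <= c by rewrite divr_ge0// sqr_ge0.
have mset B : measurable B -> measurable (Delta v @^-1` B).
  by move=> mB; rewrite -[X in measurable X]setTI; exact: measurable_funP.
have mid : (Q (Delta v @^-1` `](- c)%R, c]) <= (s / Num.sqrt (2 * pi))%:E)%E.
  (* A null direction [v] has no Gaussian density, but then the interval is empty. *)
  have [s0|s0] := eqVneq s 0.
    rewrite (_ : Delta v @^-1` _ = set0) ?measure0 ?s0 ?mul0r//.
    apply/seteqP; split=> w //=; rewrite in_itv/= /c s0 expr0n/= mul0r oppr0.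
    by move=> /andP[/lt_le_trans h /h]; rewrite ltxx.
  have sp : 0 < s by rewrite lt_neqAle eq_sym s0 l2norm_ge0.
  rewrite (isonormal_law iso sp)// -?sqr_l2norm//.
  exact: normal_prob_half_open_le.
have -> : [set w | Delta v w <= - c] = Delta v @^-1` `]-oo, - c].
  by apply/seteqP; split=> w; rewrite /= in_itv.
have -> : [set w | c < Delta v w] = Delta v @^-1` `]c, +oo[.
  by apply/seteqP; split=> w; rewrite /= in_itv/= andbT.
have tot : (Q (Delta v @^-1` `]-oo, (- c)%R]) + Q (Delta v @^-1` `]c, +oo[) +
    Q (Delta v @^-1` `](- c)%R, c]) = 1)%E.
  rewrite -(@probability_setT _ _ _ Q) -measureU//; [|exact: mset..|].
    rewrite -measureU//; [|exact: measurableU (mset _ _) (mset _ _)|exact: mset|].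
      congr (Q _); rewrite -!preimage_setU; apply/seteqP; split=> // w _ /=.
      rewrite !in_itv/= andbT.
      case: (leP (Delta v w) (- c)) => [|_]; first by left; left.
      by case: (leP (Delta v w) c) => [|_]; [right|left; right].
    rewrite -preimage_setU -preimage_setI; apply/seteqP; split=> w //=.
    rewrite !in_itv/= andbT => -[[|] h /andP[h1' h2']].
      by move: h1'; rewrite ltNge h.
    by move: h; rewrite ltNge h2'.
  rewrite -preimage_setI; apply/seteqP; split=> w //=.
  rewrite !in_itv/= andbT => -[h h']; have := lt_le_trans h' h; lra.
rewrite EFinB leeBlDr// -tot; exact: leeD2l.
Qed.

Let mshift h : measurable_fun setT (shifted Delta h) := measurable_shifted Delta h.

(** Adding the fixed shift by [h2] is a measurable map of observations, which reduces the comparison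
    to the shifts by [v] and by 0. *)
Lemma shifted_cameron_martin A : measurable A ->
  Q (shifted Delta h1 @^-1` A) =
  (\int[Q]_(w in shifted Delta h2 @^-1` A)
     (expR (Delta v w - s ^+ 2 / 2))%:E)%E.
Proof.
move=> mA.
pose tau (z : observation K) : observation K := fun g => z g + l2dot h2 (val g).
have mtau : measurable_fun setT tau.
  apply: measurable_to_observation => g; apply: measurable_funD => //.
  exact: measurable_evaluation.
have -> : shifted Delta h1 @^-1` A = shifted Delta (val v) @^-1` (tau @^-1` A).
  rewrite -[RHS]comp_preimage; congr (_ @^-1` A); apply/funext => w; apply/funext => g.
  by rewrite /= /tau /shifted vE l2dotBl; ring.
rewrite (cameron_martin iso); last by rewrite -[X in measurable X]setTI; exact: mtau.
by rewrite /s sqr_l2norm.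
Qed.

(** Both laws dominate a common measure of mass at least 1 - s / sqrt (2 pi), and the two squares
    add up to at least (a - b)^2 / 2 at every point. *)
Lemma two_point_bound (F : observation K -> R) (a b : R) :
  measurable_fun setT F ->
  (((a - b) ^+ 2 / 2 * (1 - s / Num.sqrt (2 * pi)))%:E <=
   \int[Q]_w ((F (shifted Delta h1 w) - a) ^+ 2)%:E +
   \int[Q]_w ((F (shifted Delta h2 w) - b) ^+ 2)%:E)%E.
Proof.
move=> mF.
(* On E the likelihood ratio is at most 1, so the measure m below, nu1 on E and
   nu2 off E, is the minimum of the two laws. *)
pose E : set (observation K) := [set z | z v <= l2dot h2 (val v) + s ^+ 2 / 2].
have mE : measurable E.
  rewrite (_ : E = (fun z : observation K => z v) @^-1` `]-oo, l2dot h2 (val v) + s ^+ 2 / 2]).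
    by rewrite -[X in measurable X]setTI; apply: (measurable_evaluation v).
  by apply/seteqP; split=> z; rewrite /= in_itv.
have mEc : measurable (~` E) by exact: measurableC.
pose X1 : {mfun Omega >-> observation K} :=
  HB.pack (shifted Delta h1) (isMeasurableFun.Build _ _ _ _ _ (mshift h1)).
pose X2 : {mfun Omega >-> observation K} :=
  HB.pack (shifted Delta h2) (isMeasurableFun.Build _ _ _ _ _ (mshift h2)).
pose nu1 := distribution Q X1.
pose nu2 := distribution Q X2.
have nuE A : measurable A ->
  nu1 A = (\int[Q]_(w in shifted Delta h2 @^-1` A) (expR (Delta v w - s ^+ 2 / 2))%:E)%E.
  exact: shifted_cameron_martin.
have mpre A : measurable A -> measurable (shifted Delta h2 @^-1` A).
  by move=> mA; rewrite -[X in measurable X]setTI; exact: mshift.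
have mL : measurable_fun setT (fun w => (expR (Delta v w - s ^+ 2 / 2))%:E).
  by apply/measurable_EFinP; apply: measurableT_comp => //; exact: measurable_funB.
have nu2E A : measurable A -> nu2 A = (\int[Q]_(w in shifted Delta h2 @^-1` A) 1)%E.
  by move=> mA; rewrite integral_cst ?mul1e//; exact: mpre.
have le12 A : measurable A -> A `<=` E -> (nu1 A <= nu2 A)%E.
  move=> mA AE; rewrite nuE// nu2E//; apply: ge0_le_integral => //.
  - exact: mpre.
  - exact: measurable_funTS.
  - move=> w /AE; rewrite /E /= /shifted addrC lerD2l => h.
    by rewrite lee_fin -[leRHS]expR0 ler_expR subr_le0.
have le21 A : measurable A -> A `<=` ~` E -> (nu2 A <= nu1 A)%E.
  move=> mA AE; rewrite nuE// nu2E//; apply: ge0_le_integral => //.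
  - exact: mpre.
  - exact: measurable_funTS.
  - move=> w /AE nE; rewrite lee_fin -[leLHS]expR0 ler_expR subr_ge0 leNgt.
    by apply/negP => h; apply: nE; rewrite /E /= /shifted addrC lerD2l ltW.
pose m := measure_add (mrestr nu1 mE) (mrestr nu2 mEc).
have splitE (nu : probability (observation K) R) S : measurable S ->
    nu S = (nu (S `&` E) + nu (S `&` ~` E))%E.
  move=> mS; rewrite -measureU//; [|exact: measurableI..|].
    by rewrite -setIUr setUv setIT.
  by rewrite setIACA setICr setI0.
have m_le1 S : measurable S -> (m S <= nu1 S)%E.
  move=> mS; rewrite /m measure_addE [leRHS](splitE nu1 S mS) leeD2l//.
  by apply: le21; [exact: measurableI|exact: subIsetr].
have m_le2 S : measurable S -> (m S <= nu2 S)%E.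
  move=> mS; rewrite /m measure_addE [leRHS](splitE nu2 S mS) leeD2r//.
  by apply: le12; [exact: measurableI|exact: subIsetr].
have mf c : measurable_fun setT (fun z => ((F z - c) ^+ 2)%:E).
  by apply/measurable_EFinP; apply: measurable_funX; exact: measurable_funB.
have f0 c z : (0 <= ((F z - c) ^+ 2)%:E)%E by rewrite lee_fin sqr_ge0.
rewrite -[X in (_ <= X + _)%E](ge0_integral_distribution X1 (mf a) (f0 a)).
rewrite -[X in (_ <= _ + X)%E](ge0_integral_distribution X2 (mf b) (f0 b)).
apply: le_trans (leeD (ge0_le_measure_integral m_le1 measurableT (f0 a) (mf a))
  (ge0_le_measure_integral m_le2 measurableT (f0 b) (mf b))).
rewrite -ge0_integralD//.
apply: (@le_trans _ _ (\int[m]_z ((a - b) ^+ 2 / 2)%:E)%E); last first.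
  apply: ge0_le_integral => //.
  - by move=> z _; rewrite lee_fin divr_ge0// sqr_ge0.
  - exact: emeasurable_funD.
  - move=> z _; rewrite -EFinD lee_fin.
    by have := sqr_ge0 ((F z - a) + (F z - b)); lra.
rewrite integral_cst// EFinM lee_wpmul2l//.
  by rewrite lee_fin divr_ge0// sqr_ge0.
apply: le_trans isonormal_affinity _.
rewrite [leRHS](_ : _ = nu1 E + nu2 (~` E))%E; last first.
  by rewrite [LHS]measure_addE /= /mrestr !setTI.
(* Along [v] the two shifts differ by s^2, which moves the threshold s^2 / 2 to its opposite. *)
have <- : shifted Delta h1 @^-1` E = [set w | Delta v w <= - (s ^+ 2 / 2)].
  apply/seteqP; split=> w; rewrite /E /= /shifted (_ : l2dot h1 _ = s ^+ 2 + l2dot h2 (val v)).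
  - by move=> h; lra.
  - by rewrite /s sqr_l2norm {2}vE l2dotBl subrK.
  - by move=> h; lra.
  - by rewrite /s sqr_l2norm {2}vE l2dotBl subrK.
have <- // : shifted Delta h2 @^-1` (~` E) = [set w | s ^+ 2 / 2 < Delta v w].
apply/seteqP; split=> w; rewrite /E /= /shifted.
- by move=> /negP; rewrite -ltNge => h; lra.
- by move=> h; apply/negP; rewrite -ltNge; lra.
Qed.

End two_point.

(** * Boundedness of the directional derivative *)

Section dqm_error.
Context d (X : measurableType d) (R : realType) (P : probability X R).

Lemma measurable_sqrt_density (Q : probability X R)
    (mu : {sigma_finite_measure set X -> \bar R}) :
  Q `<< mu -> measurable_fun setT (sqrt_density Q mu).
Proof.
move=> Qmu.
have ms : measurable_fun [set: R] (@Num.sqrt R).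
  by apply: continuous_measurable_fun; exact: sqrt_continuous.
by apply: (measurableT_comp ms); exact: measurableT_comp.
Qed.

(** The square of [sqrt_density P mu] is almost everywhere the Radon-Nikodym derivative of P, so the
    integral is one against P. *)
Lemma integral_sqr_sqrt_density (mu : {sigma_finite_measure set X -> \bar R})
    (h : L2 P) : P `<< mu ->
  (\int[mu]_x ((h x * sqrt_density P mu x) ^+ 2)%:E = (l2norm h ^+ 2)%:E)%E.
Proof.
move=> Pmu; have mh2 : measurable_fun setT (fun x => (h x ^+ 2)%:E).
  by apply/measurable_EFinP; exact: measurable_funX.
have h20 x : (0 <= (h x ^+ 2)%:E)%E by rewrite lee_fin sqr_ge0.
rewrite sqr_l2norm -l2dotE.
rewrite -(Radon_Nikodym_SigmaFinite.change_of_variables Pmu h20 measurableT mh2).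
apply: ae_eq_integral => //.
- apply/measurable_EFinP; apply: measurable_funX; apply: measurable_funM => //.
  exact: measurable_sqrt_density.
- apply: emeasurable_funM => //.
  exact: measurable_int (Radon_Nikodym_SigmaFinite.f_integrable Pmu).
have := ae_eq_Radon_Nikodym_SigmaFinite Pmu measurableT.
apply: filterS => x /(_ I) fE _; rewrite /sqrt_density -fE.
rewrite exprMn sqr_sqrtr ?fine_ge0 ?Radon_Nikodym_SigmaFinite.f_ge0//.
by rewrite EFinM fineK// Radon_Nikodym_SigmaFinite.f_fin_num.
Qed.

(** Pointwise, f^2 <= 2 (f - g/2)^2 + g^2 / 2, the difference being (f - g)^2. *)
Lemma dqm_error0_le (Q : probability X R) (h : L2 P) (t : R) :
  (dqm_error Q (0%R : L2 P) t <=
   2%:E * dqm_error Q h t + (l2norm h ^+ 2 / 2)%:E)%E.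
Proof.
pose mu : {sigma_finite_measure set X -> \bar R} := measure_add P Q.
have Pmu : P `<< mu.
  apply/null_content_dominatesP => A mA muA0.
  have : (P A + Q A = 0)%E by rewrite -measure_addE; exact: muA0.
  by move/eqP; rewrite padde_eq0 ?measure_ge0// => /andP[/eqP].
have Qmu : Q `<< mu.
  apply/null_content_dominatesP => A mA muA0.
  have : (P A + Q A = 0)%E by rewrite -measure_addE; exact: muA0.
  by move/eqP; rewrite padde_eq0 ?measure_ge0// => /andP[_ /eqP].
have mP := measurable_sqrt_density Pmu; have mQ := measurable_sqrt_density Qmu.
pose f x := (sqrt_density Q mu x - sqrt_density P mu x) / t.
pose g x := h x * sqrt_density P mu x.
have mf : measurable_fun setT f.
  by apply: measurable_funM => //; exact: measurable_funB.
have mg : measurable_fun setT g by exact: measurable_funM.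
have msq (u : X -> R) : measurable_fun setT u ->
    measurable_fun setT (fun x => (u x ^+ 2)%:E).
  by move=> mu'; apply/measurable_EFinP; exact: measurable_funX.
have sq0 (u : X -> R) x : (0 <= (u x ^+ 2)%:E)%E by rewrite lee_fin sqr_ge0.
have mfg : measurable_fun setT (fun x => f x - 2^-1 * g x).
  by apply: measurable_funB => //; exact: measurable_funM.
have -> : dqm_error Q (0%R : L2 P) t = (\int[mu]_x (f x ^+ 2)%:E)%E.
  apply: eq_integral => x _; congr (_ ^+ 2)%:E.
  by rewrite -[(0%R : L2 P) x]/(0 : R) mulr0 mul0r subr0.
have -> : dqm_error Q h t = (\int[mu]_x ((f x - 2^-1 * g x) ^+ 2)%:E)%E.
  by apply: eq_integral => x _; congr (_ ^+ 2)%:E; rewrite /f /g mulrA.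
have -> : (l2norm h ^+ 2 / 2)%:E = (2^-1%:E * \int[mu]_x (g x ^+ 2)%:E)%E.
  by rewrite integral_sqr_sqrt_density// -EFinM mulrC.
have scaleE (c : R) (u : X -> R) : 0 <= c -> measurable_fun setT u ->
    (c%:E * (\int[mu]_x (u x ^+ 2)%:E) = \int[mu]_x (c * u x ^+ 2)%:E)%E.
  move=> c0 mu'; under [RHS]eq_integral do rewrite EFinM.
  by rewrite ge0_integralZl//; exact: msq.
have mscale (c : R) (u : X -> R) : measurable_fun setT u ->
    measurable_fun setT (fun x => (c * u x ^+ 2)%:E).
  by move=> mu'; apply/measurable_EFinP/measurable_funM => //; exact: measurable_funX.
have scale0 (c : R) (u : X -> R) x : 0 <= c -> (0 <= (c * u x ^+ 2)%:E)%E.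
  by move=> c0; rewrite lee_fin mulr_ge0// sqr_ge0.
rewrite !scaleE ?invr_ge0//.
rewrite -ge0_integralD//; last 4 first.
- by move=> x _; exact: (scale0 2 (fun x => f x - 2^-1 * g x)).
- exact: mscale.
- by move=> x _; apply: (scale0 2^-1 g); rewrite invr_ge0.
- exact: mscale.
apply: ge0_le_integral => //.
- exact: msq.
- by apply: emeasurable_funD; exact: mscale.
- move=> x _; rewrite -EFinD lee_fin.
  by have := sqr_ge0 (f x - g x); lra.
Qed.

Lemma dqm_error_ge0 (Q : probability X R) (h : L2 P) (t : R) :
  (0 <= dqm_error Q h t)%E.
Proof. by apply: integral_ge0 => x _; rewrite lee_fin sqr_ge0. Qed.

Lemma dqm_error0_refl (t : R) : dqm_error P (0%R : L2 P) t = 0%E.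
Proof.
apply: integral0_eq => x _.
by rewrite -[(0%R : L2 P) x]/(0 : R) mulr0 mul0r subrr mul0r subr0 expr0n.
Qed.

End dqm_error.

Section boundedness.
Context d (X : measurableType d) (R : realType) (P : probability X R).
Variables (PP : set (probability X R)) (Psi : probability X R -> R).
Variables (T : set (L2 P)) (gamma : L2 P -> R).
Hypothesis PPP : PP P.
Hypothesis T_subspace : linear_subspace T.
Hypothesis T_real : path_realization PP T.
Hypothesis gamma_der : directional_derivative PP Psi T gamma.

Lemma near0_rightP (A : set R) : (\forall t \near 0^'+, A t) ->
  exists2 e : R, 0 < e & forall t, 0 < t < e -> A t.
Proof.
move=> /nbhs_ballP[e /= e0 eA]; exists e => // t /andP[t0 te].
by apply: eA => //; rewrite /ball /= sub0r normrN gtr0_norm.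
Qed.

Lemma gamma0 : gamma 0 = 0.
Proof.
have [homog _] := gamma_der; have [T0 _] := T_subspace.
by have := homog 2 0 (ltr0n _ 2) T0; rewrite scaler0; lra.
Qed.

(** The tolerance 1/2 keeps the difference quotient above 1/2 in absolute value whenever |gamma h|
    >= 1. *)
Lemma path_point (h : L2 P) (e : R) : T h -> 0 < e ->
  exists (t : R) (Q : probability X R),
    [/\ 0 < t < e, PP Q, (dqm_error Q h t < e%:E)%E
      & `|t^-1 * (Psi Q - Psi P) - gamma h| < 2^-1].
Proof.
move=> Th e0; have [_ /(_ h Th)[p ph]] := T_real.
have [_ /(_ h p Th ph) der] := gamma_der.
have [[eps eps0 epsP] p0 err] := ph.
have : \forall t \near 0^'+, [/\ 0 < t < e, PP (p t), (dqm_error (p t) h t < e%:E)%E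
      & `|t^-1 * (Psi (p t) - Psi P) - gamma h| < 2^-1].
  have /fine_cvgP[efin /cvgrPdist_lt errlt] := err.
  move/cvgrPdist_lt : der => der.
  near=> t; have t0 : 0 < t by [].
  split.
  - by rewrite t0/=; near: t; exact: nbhs_right_lt.
  - by apply: epsP; rewrite ltW//=; near: t; exact: nbhs_right_lt.
  - have tfin : dqm_error (p t) h t \is a fin_num by near: t.
    rewrite -(fineK tfin) lte_fin (le_lt_trans (ler_norm _))//.
    by rewrite -normrN -[- _]sub0r; near: t; exact: errlt.
  - by rewrite distrC; near: t; apply: der; rewrite invr_gt0.
move=> /near0_rightP[e' e'0 H].
have [|h1 h2 h3 h4] := H (e' / 2); first by apply/andP; split; lra.
by exists (e' / 2), (p (e' / 2)).
Unshelve. all: by end_near. Qed.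

Lemma gamma_small (g : nat -> L2 P) :
  (forall n, T (g n)) -> (forall n, l2norm (g n) <= n.+1%:R^-1) ->
  exists n, `|gamma (g n)| < 1.
Proof.
move=> Tg g_small; apply: contrapT => /forallNP gbig.
have e0 n : 0 < n.+1%:R^-1 :> R by rewrite invr_gt0.
have /choice[t] n := path_point (Tg n) (e0 n).
move=> /choice[Q tQ].
have t0 n : 0 < t n by have [/andP[]] := tQ n.
have te n : t n < n.+1%:R^-1 by have [/andP[]] := tQ n.
(* The t n need not be distinct: q selects some index realizing s. *)
pose q s := if pselect (exists n, s = t n) is left e then Q (projT1 (cid e)) else P.
have qt n : exists2 m, t n = t m & q (t n) = Q m.
  rewrite /q; case: pselect => [e|[]]; last by exists n.
  by case: cid => m /= tm; exists m.
have qP s : (exists2 n, s = t n & q s = Q n) \/ q s = P.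
  rewrite /q; case: pselect => [e|_]; [left|by right].
  by case: cid => m /= tm; exists m.
(* Near time 0 the glued path meets only points of large index, whose errors are small. *)
have t_far N : \forall s \near 0^'+, forall n, (n < N)%N -> s < t n.
  elim: N => [|N IH]; first by near=> s.
  near=> s => n; rewrite ltnS leq_eqVlt => /predU1P[->|nN].
    by near: s; exact: nbhs_right_lt.
  by move: n nN; near: s.
have qpath : DQM_path PP q (0 : L2 P).
  split.
  - exists 1 => // s _; case: (qP s) => [[n _ ->]|->//].
    by have [] := tQ n.
  - case: (qP 0) => [[n tn0 _]|q0]; last exact: q0.
    by have := t0 n; rewrite -tn0 ltxx.
  - have err_le (e : R) : 0 < e -> \forall s \near 0^'+, (dqm_error (q s) (0%R : L2 P) s <= e%:E)%E.
      (* The error at a point of index n is at most 2/(n+1) + 1/(2(n+1)), which is below 3/(n+1). *)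
      move=> ep; have [N Ne] : exists N : nat, 3 / e < N.+1%:R.
        by exists (Num.truncn (3 / e)); exact: truncnS_gt.
      near=> s; case: (qP s) => [[n stn ->]|->]; last first.
        by rewrite dqm_error0_refl lee_fin ltW.
      have Nn : (N <= n)%N.
        rewrite leqNgt; apply/negP => nN; have : s < t n by move: n nN {stn}; near: s.
        by rewrite stn ltxx.
      apply: le_trans (dqm_error0_le (Q n) (g n) s) _.
      have [_ _ + _] := tQ n; rewrite -stn => Qn.
      apply: (@le_trans _ _ (2%:E * n.+1%:R^-1%:E + (n.+1%:R^-1 / 2)%:E)%E).
        rewrite leeD// ?lee_pmul2l ?(ltW Qn)//.
        rewrite lee_fin ler_pM2r ?invr_gt0// expr2.
        rewrite (le_trans (ler_pM (l2norm_ge0 _) (l2norm_ge0 _) (g_small n) (g_small n)))//.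
        by rewrite ler_piMl ?invf_le1 ?ler1n// invr_ge0.
      rewrite -EFinM -EFinD lee_fin.
      have nN : n.+1%:R^-1 <= N.+1%:R^-1 :> R by rewrite lef_pV2 ?posrE// ler_nat.
      have : N.+1%:R^-1 <= e / 3.
        by rewrite -[e / 3]invrK lef_pV2 ?posrE ?invr_gt0 ?divr_gt0// invf_div ltW.
      have lin (x y z : R) : 0 < x -> x <= y -> y <= z / 3 -> 2 * x + x / 2 <= z by lra.
      exact: lin (e0 n) nN.
    apply/fine_cvgP; split.
      have := err_le 1 ltr01; apply: filterS => s h1.
      by rewrite ge0_fin_numE ?dqm_error_ge0// (le_lt_trans h1)// ltry.
    apply/cvgrPdist_le => e ep; have := err_le e ep; apply: filterS => s hs.
    rewrite sub0r normrN ger0_norm ?fine_ge0 ?dqm_error_ge0//.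
    rewrite -lee_fin fineK// ge0_fin_numE ?dqm_error_ge0//.
    by rewrite (le_lt_trans hs)// ltry.
have [T0 _] := T_subspace; have [_ /(_ 0 q T0 qpath)] := gamma_der.
rewrite gamma0 => /cvgrPdist_lt/(_ 2^-1).
rewrite invr_gt0 => /(_ (ltr0n _ 2))/near0_rightP[e ep eP].
have [n ne] : exists n : nat, e^-1 < n.+1%:R.
  by exists (Num.truncn e^-1); exact: truncnS_gt.
have tne : 0 < t n < e.
  by rewrite t0/= (lt_trans (te n))// -[e]invrK ltf_pV2 ?posrE ?invr_gt0.
(* The quotient at this time is below 1/2 in absolute value and within 1/2 of [gamma (g m)], against
   [gbig m]. *)
have := eP _ tne; have [m tnm ->] := qt n; rewrite tnm sub0r normrN => small.
have [_ _ _ close] := tQ m; apply: (gbig m).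
move: small close; rewrite !ltr_norml => /andP[? ?] /andP[? ?].
by apply/andP; split; lra.
Unshelve. all: by end_near. Qed.

(** If |gamma (h n)| > n+1 on the unit ball, then the scores h n / (n+1) have norm at most 1/(n+1)
    while |gamma| exceeds 1 on them. *)
Lemma gamma_bounded : exists M : R, forall h, T h -> l2norm h <= 1 ->
  `|gamma h| <= M.
Proof.
apply: contrapT => /forallNP unb.
have /choice[h hP] n : exists h, [/\ T h, l2norm h <= 1 & n.+1%:R < `|gamma h|].
  apply: contrapT => /forallNP H; apply: (unb n.+1%:R) => h Th h1.
  by rewrite leNgt; apply/negP => ?; apply: (H h).
have n0 n : 0 < n.+1%:R^-1 :> R by rewrite invr_gt0.
have [homog _] := gamma_der; have [T0 Tlin] := T_subspace.
have [n|n|n] := @gamma_small (fun n => n.+1%:R^-1 *: h n).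
- by rewrite -[X in T X]addr0; apply: Tlin => //; have [] := hP n.
- have [_ h1 _] := hP n.
  by rewrite l2normZ gtr0_norm// ler_piMr// ltW.
- have [Th _ big] := hP n.
  by rewrite homog// normrM gtr0_norm// ltr_pdivrMl// mulr1 ltNge ltW.
Qed.

End boundedness.

(** * Minimax risk *)

Section minimax.
Context d (X : measurableType d) (R : realType) (P : probability X R).
Variables (T : set (L2 P)) (gamma : L2 P -> R).
Hypothesis T_subspace : linear_subspace T.
Let K := core_perp T gamma.

Lemma core_perp_lin (c : R) f g : K f -> K g -> K (c *: f + g).
Proof.
move=> [Tf f0] [Tg g0]; split; first by have [_] := T_subspace; apply.
by move=> w cw; rewrite l2dotDl l2dotZl f0// g0// mulr0 addr0.
Qed.

Lemma core_perp0 : K 0.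
Proof.
split; first by have [] := T_subspace.
by move=> w _; rewrite -(scale0r (0 : L2 P)) l2dotZl mul0r.
Qed.

Lemma perp_ballZ (r c : R) h : 0 <= c -> perp_ball T gamma r h ->
  perp_ball T gamma (c * r) (c *: h).
Proof.
move=> c0 [Kh hr]; split; last by rewrite l2normZ ger0_norm// ler_wpM2l.
by rewrite -[_ *: _]addr0; apply: core_perp_lin => //; exact: core_perp0.
Qed.

Lemma perp_ball0 (r : R) : 0 <= r -> perp_ball T gamma r 0.
Proof.
move=> r0; split; first exact: core_perp0.
by rewrite -(scale0r (0 : L2 P)) l2normZ normr0 mul0r.
Qed.

Context d' (Omega : measurableType d') (Q : probability Omega R).
Variables (Delta : K -> {RV Q >-> R}).
Hypothesis iso : isonormal Delta.

Lemma risk_ge0 dU (U : measurableType dU) (q : probability U R)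
    (S : observation K * U -> R) h : (0 <= risk Delta q S h)%E.
Proof. by apply: integral_ge0 => w _; rewrite lee_fin sqr_ge0. Qed.

Lemma risk_cst dU (U : measurableType dU) (q : probability U R) (c : R) h :
  risk Delta q (cst c) h = ((c - gamma h) ^+ 2)%:E.
Proof.
have QqT : (Q \x q)%E [set: Omega * U] = 1%E.
  rewrite -setXTT; apply: etrans (product_measure1E Q q measurableT measurableT) _.
  rewrite [X in (X * _)%E](@probability_setT _ _ _ Q).
  by rewrite [X in (_ * X)%E](@probability_setT _ _ _ q) mule1.
transitivity (\int[Q \x q]_w (cst ((c - gamma h) ^+ 2)%:E) w)%E; first by [].
by rewrite integral_cst// [X in (_ * X)%E]QqT mule1.
Qed.

(** For each fixed value of the randomization, [S] is an ordinary statistic obeying the two-point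
    bound; the bound is then averaged over [q]. *)
Lemma risk_two_point dU (U : measurableType dU) (q : probability U R)
    (S : observation K * U -> R) h1 h2 :
  measurable_fun setT S -> K h1 -> K h2 ->
  (((gamma h1 - gamma h2) ^+ 2 / 2 *
     (1 - l2norm (h1 - h2) / Num.sqrt (2 * pi)))%:E <=
   risk Delta q S h1 + risk Delta q S h2)%E.
Proof.
move=> mS K1 K2.
have K12 : K (h1 - h2) by rewrite addrC -scaleN1r; exact: core_perp_lin.
pose v : K := exist _ (h1 - h2) (mem_set K12).
pose f h (p : Omega * U) := ((S (shifted Delta h p.1, p.2) - gamma h) ^+ 2)%:E.
have mf h : measurable_fun setT (f h).
  apply/measurable_EFinP; apply: measurable_funX; apply: measurable_funB => //.
  apply: (measurableT_comp mS); apply: measurable_fun_pair => //.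
  exact: (measurableT_comp (measurable_shifted Delta h) measurable_fst).
have f0 h p : (0 <= f h p)%E by rewrite lee_fin sqr_ge0.
have riskE h : risk Delta q S h = (\int[q]_u \int[Q]_w f h (w, u))%E.
  exact: (fubini_tonelli2 (f h) (mf h) (f0 h)).
have mG h : measurable_fun setT (fun u => \int[Q]_w f h (w, u))%E.
  exact: (measurable_fun_fubini_tonelli_G (f h) (mf h) (f0 h)).
(* The bound is negative when |h1 - h2| exceeds sqrt (2 pi), whereas the comparison of integrals
   below is for nonnegative integrands. *)
set c := (X in X%:E); have [c0|c0] := leP c 0.
  by apply: (@le_trans _ _ 0%E); rewrite ?lee_fin// adde_ge0// risk_ge0.
rewrite !riskE -ge0_integralD//; [|by move=> u _; exact: integral_ge0..].
apply: (@le_trans _ _ (\int[q]_u c%:E)%E).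
  by rewrite integral_cst// [X in (_ * X)%E](@probability_setT _ _ _ q) mule1.
apply: ge0_le_integral => //.
- by move=> u _; rewrite lee_fin ltW.
- exact: emeasurable_funD.
- move=> u _; apply: (two_point_bound iso (v := v) erefl (F := fun z => S (z, u))).
  exact: (measurableT_comp mS (pair2_measurable u)).
Qed.

Let kappa (r : R) := Num.max (1 - 2 * r / Num.sqrt (2 * pi)) 0.

Lemma minimax_risk_two_point (r : R) h1 h2 :
  perp_ball T gamma r h1 -> perp_ball T gamma r h2 ->
  (((gamma h1 - gamma h2) ^+ 2 / 4 * kappa r)%:E <= minimax_risk Delta r)%E.
Proof.
move=> B1 B2; apply: le_ereal_inf_tmp => _ [dU [U [q [S [mS ->]]]]].
have [[K1 h1r] [K2 h2r]] := (B1, B2).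
have sup1 : (risk Delta q S h1 <= ereal_sup [set risk Delta q S h | h in perp_ball T gamma r])%E.
  by apply: ereal_sup_ubound; exists h1.
have sup2 : (risk Delta q S h2 <= ereal_sup [set risk Delta q S h | h in perp_ball T gamma r])%E.
  by apply: ereal_sup_ubound; exists h2.
have sum : (((gamma h1 - gamma h2) ^+ 2 / 2 * kappa r)%:E <=
    risk Delta q S h1 + risk Delta q S h2)%E.
  rewrite /kappa; case: (leP (1 - 2 * r / Num.sqrt (2 * pi)) 0) => [_|_].
    by rewrite mulr0 adde_ge0// risk_ge0.
  apply: le_trans (risk_two_point q mS K1 K2); rewrite lee_fin.
  apply: ler_wpM2l; first by rewrite divr_ge0// sqr_ge0.
  rewrite lerD2l lerN2 ler_wpM2r ?invr_ge0//.
  by rewrite (le_trans (ler_l2normB _ _))//; lra.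
(* A supremum below the bound would put both risks, hence their sum, too low; this form of the
   argument also covers infinite risks. *)
rewrite leNgt; apply/negP => lt; move: sum; rewrite leNgt => /negP; apply.
have -> : ((gamma h1 - gamma h2) ^+ 2 / 2 * kappa r)%:E =
   (((gamma h1 - gamma h2) ^+ 2 / 4 * kappa r)%:E +
   ((gamma h1 - gamma h2) ^+ 2 / 4 * kappa r)%:E)%E.
  by rewrite -EFinD; congr EFin; field.
by apply: lteD; [exact: le_lt_trans sup1 _|exact: le_lt_trans sup2 _].
Qed.

Hypothesis homog : forall (c : R) h, 0 < c -> T h -> gamma (c *: h) = c * gamma h.
Hypothesis bounded : exists M : R, forall h, T h -> l2norm h <= 1 ->
  `|gamma h| <= M.

Let A := gamma @` perp_ball T gamma 1.

Lemma has_sup_perp_ball : has_sup A.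
Proof.
split; first by exists (gamma 0), 0 => //; exact: perp_ball0.
have [M HM] := bounded; exists M => _ [h [[Th _] h1] <-].
by rewrite (le_trans (ler_norm _))// HM.
Qed.

Lemma has_inf_perp_ball : has_inf A.
Proof.
split; first by exists (gamma 0), 0 => //; exact: perp_ball0.
have [M HM] := bounded; exists (- M) => _ [h [[Th _] h1] <-].
by rewrite lerNl (le_trans (ler_norm _))// normrN HM.
Qed.

Let D := perp_range T gamma.

Lemma perp_range_ge0 : 0 <= D.
Proof.
have A0 : A (gamma 0) by exists 0 => //; exact: perp_ball0.
rewrite subr_ge0 (@le_trans _ _ (gamma 0))//.
  by apply: ge_inf => //; have [] := has_inf_perp_ball.
by apply: ub_le_sup => //; have [] := has_sup_perp_ball.
Qed.

Lemma minimax_risk_le (r : R) : 0 < r ->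
  (minimax_risk Delta r <= (D ^+ 2 * r ^+ 2 / 4)%:E)%E.
Proof.
move=> r0; pose c := r * ((sup A + inf A) / 2).
apply: (@le_trans _ _ (ereal_sup [set risk Delta Q (cst c : observation K * Omega -> R) h
    | h in perp_ball T gamma r])).
  (* A constant ignores the randomization, so any probability space at hand can carry it. *)
  by apply: ereal_inf_lbound; exists d', Omega, Q, (cst c); split.
apply: ge_ereal_sup => _ [h hr <-].
rewrite risk_cst lee_fin.
have r'0 : 0 <= r^-1 by rewrite invr_ge0 ltW.
have := perp_ballZ r'0 hr; rewrite mulVf ?gt_eqF// => h1.
have A1 : A (r^-1 * gamma h).
  have [[Th _] _] := hr.
  by exists (r^-1 *: h) => //; rewrite homog// invr_gt0.
have lo : inf A <= r^-1 * gamma h by apply: ge_inf => //; have [] := has_inf_perp_ball.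
have up : r^-1 * gamma h <= sup A by apply: ub_le_sup => //; have [] := has_sup_perp_ball.
have -> : gamma h = r * (r^-1 * gamma h) by rewrite mulVKf// gt_eqF.
set y := r^-1 * gamma h in lo up *.
have -> : D ^+ 2 * r ^+ 2 / 4 = r ^+ 2 * ((sup A - inf A) / 2) ^+ 2.
  by rewrite /D /perp_range -/A; field.
rewrite /c -mulrBr exprMn ler_pM2l ?exprn_gt0//.
by nra.
Qed.

(** The extrema of gamma need not be attained. Square roots turn the two-point bounds into a - b <=
    sqrt (m / c) for all values a and b of gamma on the unit ball, which passes to the supremum and
    then to the infimum. *)
Lemma minimax_risk_ge (r : R) : 0 < r ->
  ((D ^+ 2 * r ^+ 2 / 4 * kappa r)%:E <= minimax_risk Delta r)%E.
Proof.
move=> r0.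
have k0 : 0 <= kappa r by rewrite le_max lexx orbT.
have M0 : (0 <= minimax_risk Delta r)%E.
  apply: le_ereal_inf_tmp => _ [dU [U [q [S [mS ->]]]]].
  apply: le_trans (risk_ge0 q S 0) _; apply: ereal_sup_ubound; exists 0 => //.
  by apply: perp_ball0; exact: ltW.
have Mfin : minimax_risk Delta r \is a fin_num.
  by rewrite ge0_fin_numE// (le_lt_trans (minimax_risk_le r0))// ltry.
have two a b : A a -> A b -> (a - b) ^+ 2 * (r ^+ 2 / 4 * kappa r) <= fine (minimax_risk Delta r).
  move=> [h1 B1 <-] [h2 B2 <-].
  have := minimax_risk_two_point (perp_ballZ (ltW r0) B1) (perp_ballZ (ltW r0) B2).
  rewrite mulr1 -(fineK Mfin) lee_fin.
  have [[T1 _] _] := B1; have [[T2 _] _] := B2.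
  by rewrite !homog//; congr (_ <= _); field.
rewrite -(fineK Mfin) lee_fin.
set m := fine _ in two *.
have -> : D ^+ 2 * r ^+ 2 / 4 * kappa r = D ^+ 2 * (r ^+ 2 / 4 * kappa r) by field.
set c := r ^+ 2 / 4 * kappa r in two *.
have c0 : 0 <= c by rewrite mulr_ge0// divr_ge0// sqr_ge0.
have m0 : 0 <= m by rewrite fine_ge0.
(* The factor [kappa r] vanishes for large [r], which would forbid dividing by [c]. *)
have [->|cn0] := eqVneq c 0; first by rewrite mulr0.
have cp : 0 < c by rewrite lt_neqAle eq_sym cn0.
rewrite -ler_pdivlMr// -ler_sqrt ?divr_ge0// sqrtr_sqr ger0_norm ?perp_range_ge0//.
have diff a b : A a -> A b -> a <= b + Num.sqrt (m / c).
  move=> Aa Ab; rewrite -lerBlDl (le_trans (ler_norm _))// -sqrtr_sqr.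
  by rewrite ler_sqrt ?divr_ge0// ler_pdivlMr// two.
have [A0 _] := has_sup_perp_ball.
rewrite /D /perp_range lerBlDl; apply: ge_sup => // a Aa.
rewrite -lerBlDr; apply: lb_le_inf => // b Ab.
by rewrite lerBlDr diff.
Qed.

Lemma minimax_risk_littleo r : (fine (minimax_risk Delta r) : R^o) =
  D ^+ 2 / 4 * r ^+ 2 +o_(r \near 0^'+) (r ^+ 2 : R^o).
Proof.
pose f (r : R) : R^o := fine (minimax_risk Delta r).
pose g (r : R) : R^o := D ^+ 2 / 4 * r ^+ 2.
have H : forall e : R, 0 < e ->
    \forall r \near 0^'+, `|(f - g) r| <= e * `|(r ^+ 2 : R^o)|.
  move=> e e0.
  (* Without the truncation at 0, the upper and lower bounds differ by q s^3. Below, q + 1 keeps the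
     divisor positive when D = 0. *)
  pose q := D ^+ 2 / 2 / Num.sqrt (2 * pi).
  have q0 : 0 <= q by rewrite divr_ge0 ?sqrtr_ge0// divr_ge0 ?sqr_ge0.
  near=> s; have s0 : 0 < s by [].
  have sq : s * q <= e.
    have : s < e / (q + 1) by near: s; apply: nbhs_right_lt; rewrite divr_gt0// ltr_wpDl.
    by rewrite ltr_pdivlMr ?ltr_wpDl// mulrDr mulr1 => /ltW; apply: le_trans; rewrite lerDl ltW.
  have up := minimax_risk_le s0; have lo := minimax_risk_ge s0.
  have Mfin : minimax_risk Delta s \is a fin_num.
    rewrite fin_numE; apply/andP; split; apply/negP => /eqP E.
      by move: lo; rewrite E leeNy_eq.
    by move: up; rewrite E leye_eq.
  move: up lo; rewrite -(fineK Mfin) !lee_fin => up lo.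
  have k1 : 1 - 2 * s / Num.sqrt (2 * pi) <= kappa s by rewrite le_max lexx.
  have L0 : 0 <= D ^+ 2 * s ^+ 2 / 4 by rewrite divr_ge0// mulr_ge0// sqr_ge0.
  rewrite (ger0_norm (sqr_ge0 s)) -[(f - g) s]/(f s - g s) /f /g distrC.
  have gE : D ^+ 2 / 4 * s ^+ 2 = D ^+ 2 * s ^+ 2 / 4 by rewrite mulrAC.
  rewrite gE ger0_norm ?subr_ge0//.
  have := ler_wpM2l L0 k1 => lo'.
  have : D ^+ 2 * s ^+ 2 / 4 * (1 - 2 * s / Num.sqrt (2 * pi)) =
      D ^+ 2 * s ^+ 2 / 4 - s * q * s ^+ 2.
    by rewrite /q; field; rewrite gt_eqF// sqrtr_gt0 mulr_gt0// pi_gt0.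
  have := ler_wpM2r (sqr_ge0 s) sq.
  by move: lo lo'; lra.
(* The expansion is an equality of functions, which is then evaluated at [r]. *)
have := (eqaddoP _ f g (fun r : R => r ^+ 2 : R^o)).2 H.
by move=> /(congr1 (fun u => u r)).
Unshelve. all: by end_near. Qed.

End minimax.

Theorem proposition10 (R : realType) (d : measure_display)
    (X : measurableType d) (PP : set (probability X R)) (P : probability X R)
    (Psi : probability X R -> R) (T : set (L2 P)) (gamma : L2 P -> R)
    (PPP : PP P)
    (T_subspace : linear_subspace T)
    (T_mean_zero : forall h, T h -> mean_zero h)
    (assumption1 : path_realization PP T)
    (gamma_derivative : directional_derivative PP Psi T gamma)
    (assumption2 : core T gamma = additivity_space T gamma)
    (d' : measure_display) (Omega : measurableType d')
    (Q : probability Omega R) (Delta : core_perp T gamma -> {RV Q >-> R})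
    (Delta_isonormal : isonormal Delta) :
  let D := perp_range T gamma in
  let M := minimax_risk Delta in
  [/\ has_sup (gamma @` perp_ball T gamma 1),
      has_inf (gamma @` perp_ball T gamma 1),
      (forall r : R, 0 < r ->
        ((D ^+ 2 * r ^+ 2 / 4
            * Num.max (1 - 2 * r / Num.sqrt (2 * pi)) 0)%:E <= M r)%E /\
        (M r <= (D ^+ 2 * r ^+ 2 / 4)%:E)%E)
    & forall r : R, (fine (M r) : R^o) =
        D ^+ 2 / 4 * r ^+ 2 +o_(r \near 0^'+) (r ^+ 2 : R^o)].
Proof.
move=> D M; have [homog _] := gamma_derivative.
have bounded := gamma_bounded PPP T_subspace assumption1 gamma_derivative.
split.
- exact: has_sup_perp_ball.
- exact: has_inf_perp_ball.
- by move=> r r0; split; [exact: minimax_risk_ge|exact: minimax_risk_le].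
- by move=> r; exact: minimax_risk_littleo.
Qed.
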